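(* Let $\omega$ be an infinite (one-sided or bi-sided) word over a finite alphabet $\mathcal A$ such that the subshift $(\Sigma_\omega,S)$ is uniquely ergodic. Assume that the complexity function $p$ of its language is unbounded and satisfies $\lim_n\frac{p(n+1)}{p(n)}=1$. Then the Benjamini–Schramm limit of the labelled Rauzy digraphs $\vec R(n)$ exists, is supported on arc-labellings of $\vec{\mathbf Z}$, and, under the identification of such labellings with $\mathcal A^{\mathbf Z}$, equals the unique $S$-invariant probability measure on the natural extension $(\tilde\Sigma_\omega,S)$.
   Context: $\Sigma_\omega$ is the closure of the shift-orbit of $\omega$ (in $\mathcal A^{\mathbf N}$ or $\mathcal A^{\mathbf Z}$). Its language $\mathcal L$ is the set of finite subwords of $\omega$, $p(n)=|\mathcal L\cap\mathcal A^n|$. The natural extension $\tilde\Sigma_\omega$ is the bi-sided subshift of all $\tau\in\mathcal A^{\mathbf Z}$ all of whose finite subwords lie in $\mathcal L$. For $n\ge1$, the labelled Rauzy digraph $\vec R(n)$ has vertex set $\mathcal L\cap\mathcal A^n$ and, for each word $aub\in\mathcal L\cap\mathcal A^{n+1}$ ($a,b\in\mathcal A$), one arc from $au$ to $ub$ carrying label $b$. Benjamini–Schramm limit: for a finite labelled digraph $G$, let $\nu_G$ be the law of the isomorphism class (preserving orientation and labels) of the rooted connected component of a uniformly random vertex, in the compact space of rooted connected labelled digraphs of bounded degree with the local topology; the limit of $(G_n)$ is the weak limit of $\nu_{G_n}$. A rooted arc-labelling of the directed line $\vec{\mathbf Z}$ (vertices $\mathbf Z$, arcs $i\to i+1$,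 root $0$) is identified with $x\in\mathcal A^{\mathbf Z}$, $x_i$ being the label of the arc $i\to i+1$. *)

(* Defs.v *)
From HB Require Import structures.
From mathcomp Require Import all_boot all_order all_algebra.
From mathcomp Require Import all_classical all_reals all_analysis.
Set Implicit Arguments.
Unset Strict Implicit.
Unset Printing Implicit Defensive.
Import Order.TTheory GRing.Theory Num.Theory numFieldNormedType.Exports.
Local Open Scope classical_set_scope.

Section Defs.
Variable A : finType.

Definition inL1 (omega : nat -> A) (w : seq A) : Prop :=
  exists k : nat, w = mkseq (fun i => omega (k + i)%N) (size w).
Definition inL2 (omega : int -> A) (w : seq A) : Prop :=
  exists k : int, w = mkseq (fun i => omega (k + i%:Z)%R) (size w).

Definition Ln (L : seq A -> Prop) (n : nat) : {set n.-tuple A} :=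
  [set t : n.-tuple A | `[< L t >]].
Definition complexity (L : seq A -> Prop) (n : nat) : nat := #|Ln L n|.

Fixpoint within {V : Type} (arc : V -> A -> V -> Prop) (v : V) (r : nat)
  (x : V) : Prop :=
  match r with
  | 0 => x = v
  | r'.+1 => within arc v r' x \/
      exists y a, within arc v r' y /\ (arc y a x \/ arc x a y)
  end.

Definition ball_iso {V : Type} (arc : V -> A -> V -> Prop) (v : V) (r : nat)
  (k : nat) (H : 'I_k -> A -> 'I_k -> bool) (o : 'I_k) : Prop :=
  exists f : 'I_k -> V,
    [/\ injective f, f o = v,
        (forall x, within arc v r x <-> exists i, f i = x) &
        (forall i a j, H i a j <-> arc (f i) a (f j))].

(* Labelled Rauzy digraph R(n): vertices L \cap A^n; one arc  au -> ub
   labelled b for each word aub in L \cap A^(n+1).  (Tuples outside L are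
   not vertices; they are never reached from vertices in L.) *)
Definition rauzy_arc (L : seq A -> Prop) (n : nat)
  (u : n.-tuple A) (b : A) (v : n.-tuple A) : Prop :=
  L (rcons u b) /\ val v = behead (rcons u b).

Definition rauzy_ball_freq (R : realType) (L : seq A -> Prop) (n r k : nat)
  (H : 'I_k -> A -> 'I_k -> bool) (o : 'I_k) : R :=
  (#|[set v in Ln L n | `[< ball_iso (@rauzy_arc L n) v r H o >]]|%:R
    / (complexity L n)%:R)%R.

Definition line_arc (x : int -> A) (i : int) (b : A) (j : int) : Prop :=
  j = (i + 1)%R /\ b = x i.

Definition spN (a0 : A) := nat -> A.
Definition spZ (a0 : A) := int -> A.
HB.instance Definition _ (a0 : A) := gen_eqMixin (spN a0).
HB.instance Definition _ (a0 : A) := gen_choiceMixin (spN a0).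
HB.instance Definition _ (a0 : A) := gen_eqMixin (spZ a0).
HB.instance Definition _ (a0 : A) := gen_choiceMixin (spZ a0).
HB.instance Definition _ (a0 : A) := isPointed.Build (spN a0) (fun _ => a0).
HB.instance Definition _ (a0 : A) := isPointed.Build (spZ a0) (fun _ => a0).

Definition cylN (a0 : A) : set (set (spN a0)) :=
  [set B | exists (i : nat) (a : A), B = [set x : spN a0 | x i = a]].
Definition cylZ (a0 : A) : set (set (spZ a0)) :=
  [set B | exists (i : int) (a : A), B = [set x : spZ a0 | x i = a]].

End Defs.

(* A^N and A^Z with the product (= Borel, A finite discrete) sigma-algebra *)
Notation SpN a0 := (g_sigma_algebraType (@cylN _ a0)).
Notation SpZ a0 := (g_sigma_algebraType (@cylZ _ a0)).

Section Defs2.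
Variable A : finType.

Definition shiftN (a0 : A) (x : SpN a0) : SpN a0 := fun i => x i.+1.
Definition shiftZ (a0 : A) (x : SpZ a0) : SpZ a0 := fun i => x (i + 1)%R.

(* Sigma_omega = closure of the shift orbit of omega (product topology). *)
Definition Sigma1 (omega : nat -> A) : set (SpN (omega 0%N)) :=
  [set x | forall n : nat, exists k : nat,
     forall i : nat, (i < n)%N -> x i = omega (k + i)%N].
Definition Sigma2 (omega : int -> A) : set (SpZ (omega 0%R)) :=
  [set x | forall n : nat, exists k : int,
     forall i : int, (`|i| <= n)%N -> x i = omega (i + k)%R].

Definition natext (a0 : A) (L : seq A -> Prop) : set (SpZ a0) :=
  [set x | forall (i : int) (n : nat), L (mkseq (fun j => x (i + j%:Z)%R) n)].

Definition shift_invariant (R : realType) {d} {T : measurableType d}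
  (S : T -> T) (mu : probability T R) : Prop :=
  forall B : set T, measurable B -> mu (S @^-1` B) = mu B.

(* (X, S) is uniquely ergodic: exactly one S-invariant (Borel) probability
   measure on X (viewed as a probability on the ambient space giving X
   full measure). *)
Definition uniquely_ergodic (R : realType) {d} {T : measurableType d}
  (S : T -> T) (X : set T) : Prop :=
  (exists mu : probability T R, shift_invariant S mu /\ mu X = 1%E) /\
  (forall mu nu : probability T R,
     shift_invariant S mu -> mu X = 1%E ->
     shift_invariant S nu -> nu X = 1%E ->
     forall B : set T, measurable B -> mu B = nu B).

Definition complexity_hyp (R : realType) (L : seq A -> Prop) : Prop :=
  (forall M : nat, exists n : nat, (M < complexity L n)%N) /\
  ((fun n => ((complexity L n.+1)%:R / (complexity L n)%:R : R)%R)
     @ \oo --> (1%R : R)).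

(* Conclusion: there is a unique S-invariant probability mu on the natural
   extension, and the Benjamini-Schramm limit of R(n) exists and equals the
   law of the rooted arc-labelled line (\vec Z, x, 0) with x ~ mu; i.e. for
   every radius r and every finite rooted labelled digraph (H,o), the
   nu_{R(n)}-probability that the r-ball of the root is ~= (H,o) converges
   to mu{x | the r-ball of 0 in (\vec Z, x) is ~= (H,o)}. *)
Definition BS_conclusion (R : realType) (a0 : A) (L : seq A -> Prop) : Prop :=
  exists mu : probability (SpZ a0) R,
    [/\ shift_invariant (@shiftZ a0) mu,
        mu (@natext a0 L) = 1%E,
        (forall nu : probability (SpZ a0) R,
            shift_invariant (@shiftZ a0) nu -> nu (@natext a0 L) = 1%E ->
            forall B : set (SpZ a0), measurable B -> nu B = mu B) &
        (forall (r k : nat) (H : 'I_k -> A -> 'I_k -> bool) (o : 'I_k),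
            (fun n => rauzy_ball_freq R L n r H o) @ \oo -->
            fine (mu [set x : SpZ a0 | ball_iso (line_arc x) 0%R r H o]))].

End Defs2.

(* Main.v *)
Require Import Defs.
From HB Require Import structures.
From mathcomp Require Import all_boot all_order all_algebra.
From mathcomp Require Import all_classical all_reals all_analysis.
From mathcomp Require Import zify ring lra.
Import Order.TTheory GRing.Theory Num.Theory numFieldNormedType.Exports.
Local Open Scope classical_set_scope.
Set Implicit Arguments.
Unset Strict Implicit.
Unset Printing Implicit Defensive.

(* Dropping a letter at either end maps the words of length n + 1 onto those of
   length n up to at most one word, so since p(n + 1) / p(n) -> 1 all but o(p(n))
   vertices of R(n) have in- and out-degree at most one and word frequencies in
   L_n become stable under extension on both sides.  A vertex whose 2r + 1
   surrounding windows are regular and distinct has a directed path as its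
   r-ball, labelled by a factor; the words with two equal windows are periodic
   and hence boundedly many.  The ball statistics of R(n) are thus asymptotically
   the frequencies of words as suffixes of elements of L_n.  Along every
   ultrafilter refining the Frechet filter those frequencies converge to a
   consistent family, hence to the cylinder values of an invariant measure on the
   natural extension.  Unique ergodicity makes this measure independent of the
   ultrafilter, so the frequencies converge. *)

(** * Counting words through windows *)

Section Fibres.
Variables (X Y : finType) (f : X -> Y) (A : {set X}) (B : {set Y}) (e : nat).
Hypothesis fAB : f @: A \subset B.
Hypothesis fe : (#|B :\: f @: A| <= e)%N.

(** Each counted [y] either has a preimage in [A] or is one of the at most [e] points missed by [f].
    Later [f] is a window map from words of length n + m to words of length n. *)
Lemma card_le_preim (P : pred Y) :
  (#|[set y in B | P y]%SET| <= #|[set x in A | P (f x)]%SET| + e)%N.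
Proof.
have sub : [set y in B | P y]%SET \subset
    (f @: [set x in A | P (f x)]%SET) :|: (B :\: f @: A).
  apply/fintype.subsetP => y; rewrite !inE => /andP[yB Py].
  case: (boolP (y \in f @: A)) => [/imsetP[x xA yE]|_]; last by rewrite yB orbT.
  by apply/orP; left; apply/imsetP; exists x => //; rewrite inE xA -yE.
apply: leq_trans (subset_leq_card sub) _.
rewrite cardsU; apply: leq_trans (leq_subr _ _) _.
by apply: leq_add => //; exact: leq_imset_card.
Qed.

(** This is [card_le_preim] for the complement of [P], subtracted from the totals. *)
Lemma card_preim_le (P : pred Y) :
  (#|[set x in A | P (f x)]%SET| + #|B|
     <= #|[set y in B | P y]%SET| + #|A| + e)%N.
Proof.
have := card_le_preim (fun y => ~~ P y).
have E1 (T : finType) (C : {set T}) (Q : pred T) :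
    (#|[set x in C | Q x]%SET| + #|[set x in C | ~~ Q x]%SET| = #|C|)%N.
  rewrite -(cardsID [set x | Q x]%SET C); congr (_ + _)%N; apply: eq_card => x;
    by rewrite !inE // andbC.
have := E1 _ B P; have := E1 _ A (fun x => P (f x)); lia.
Qed.

(** Summing fibre sizes over the image counts every point with two preimages at least twice. For a
    map that drops one letter, such points are the special words. *)
Lemma card_multiple_fibres :
  (#|[set y in B | [exists x in A, exists x' in A,
       [&& x != x', f x == y & f x' == y]]]%SET| + #|B| <= #|A| + e)%N.
Proof.
set M := [set y in B | _]%SET.
have sMf : M \subset f @: A.
  apply/fintype.subsetP => y; rewrite inE => /andP[_ /existsP[x /andP[xA]]].
  by move=> /existsP[x' /and4P[_ _ /eqP <- _]]; apply/imsetP; exists x.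
have cA : (#|M| + #|f @: A| <= #|A|)%N.
  rewrite -[#|A|]sum1_card (partition_big_imset f) /=.
  rewrite -[#|f @: A|]sum1_card -[#|M|]sum1_card.
  rewrite [X in (_ + X <= _)%N](big_setID M) [leqRHS](big_setID M) /=.
  rewrite (finset.setIidPr sMf) addnA -big_split /=.
  apply: leq_add; apply: leq_sum => y.
    rewrite inE => /andP[_ /existsP[x /andP[xA]]].
    move=> /existsP[x' /and4P[x'A xx' /eqP fx /eqP fx']].
    rewrite (bigD1 x) /=; last by rewrite xA fx eqxx.
    by rewrite (bigD1 x') //= x'A fx' eqxx eq_sym xx'.
  rewrite !inE => /andP[_ /imsetP[x xA ->]].
  by rewrite (bigD1 x) //= xA eqxx.
have := cardsID (f @: A) B; rewrite (finset.setIidPr fAB).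
move: fe cA; lia.
Qed.

End Fibres.

Section Language.
Variables (A : finType) (L : seq A -> Prop).

(* In one-sided languages only prefixes of the word may fail to extend to the
   left, whence the last clause. *)
Definition extendable_language : Prop :=
  [/\ L [::],
      forall s v t, L (s ++ v ++ t) -> L v,
      forall v j, L v -> exists2 s, size s = j & L (v ++ s) &
      forall n i, (#|[set v : n.-tuple A | `[< L v /\
        forall s, size s = i -> ~ L (s ++ v)>] ]%SET| <= i)%N].

End Language.

Section Windows.
Variables (A : finType) (a0 : A) (L : seq A -> Prop).
Hypothesis HL : extendable_language L.
Local Notation p := (complexity L).

(** Total in the offset, so that windows are tuples without size proofs; the default [a0] enters
    only when i + n > N. *)
Definition window (N n i : nat) (U : N.-tuple A) : n.-tuple A :=
  [tuple nth a0 U (i + j) | j < n].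

Lemma val_window N n i (U : N.-tuple A) : (i + n <= N)%N ->
  val (window n i U) = take n (drop i U).
Proof.
move=> inN; apply: (@eq_from_nth _ a0).
  by rewrite size_tuple size_takel // size_drop size_tuple; lia.
move=> j; rewrite size_tuple => jn.
by rewrite nth_take // nth_drop -[j]/(val (Ordinal jn)) -tnth_nth tnth_mktuple.
Qed.

Lemma nth_window N n i (U : N.-tuple A) j : (j < n)%N ->
  nth a0 (window n i U) j = nth a0 U (i + j).
Proof.
by move=> jn; rewrite -[j]/(val (Ordinal jn)) -tnth_nth tnth_mktuple.
Qed.

Lemma mem_Ln n (u : n.-tuple A) : (u \in Ln L n) = `[< L u >].
Proof. by rewrite inE. Qed.

Lemma window_lang n m i (U : (n + m).-tuple A) : (i <= m)%N ->
  L U -> L (window n i U).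
Proof.
move=> im LU; case: HL => _ fac _ _.
rewrite val_window; last by lia.
by apply: (fac (take i U) _ (drop n (drop i U))); rewrite !cat_take_drop.
Qed.

Lemma window_sub n m i : (i <= m)%N ->
  window n i @: Ln L (n + m) \subset Ln L n.
Proof.
move=> im; apply/fintype.subsetP => _ /imsetP[U UL ->].
by rewrite mem_Ln; apply/asboolP/window_lang => //; apply/asboolP; rewrite -mem_Ln.
Qed.

(** A word with some left extension of length [i] can then be prolonged by m - i letters on the
    right, which makes it a window at offset [i]. Only words without such a left extension are
    missed, and the last clause of [extendable_language] bounds their number. *)
Lemma window_deficiency n m i : (i <= m)%N ->
  (#|Ln L n :\: window n i @: Ln L (n + m)| <= i)%N.
Proof.
move=> im; case: HL => _ _ rext lext.
apply: leq_trans (lext n i); apply: subset_leq_card; apply/fintype.subsetP => v.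
rewrite !inE => /andP[nv /asboolP Lv]; split=> // s si Lsv.
have [t tm Lt] := rext _ (m - i)%N Lsv.
have sU : size ((s ++ v) ++ t) = (n + m)%N.
  by rewrite !size_cat size_tuple si tm; lia.
move/negP: nv; apply; apply/imsetP; exists (tcast sU (in_tuple ((s ++ v) ++ t))).
  by rewrite mem_Ln; apply/asboolP; rewrite val_tcast.
apply: val_inj; rewrite val_window; last by lia.
by rewrite val_tcast /= -catA -si drop_size_cat // take_size_cat // size_tuple.
Qed.

(** At offset 0 no word is missed, because every word of [L] extends to the right. *)
Lemma complexity_mono n m : (p n <= p (n + m))%N.
Proof.
have := card_le_preim (@window_deficiency n m 0 (leq0n m)) predT.
have E (T : finType) (B : {set T}) : [set x in B | predT x]%SET = B.
  by apply/finset.setP => x; rewrite !inE andbT.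
by rewrite addn0 !E.
Qed.

Lemma complexity_gt0 n : (0 < p n)%N.
Proof.
case: HL => L0 _ rext _; have [s sn Ls] := rext [::] n L0.
apply/card_gt0P; exists (tcast sn (in_tuple s)).
by rewrite mem_Ln; apply/asboolP; rewrite val_tcast.
Qed.

Lemma window_count_le n m i (P : pred (n.-tuple A)) : (i <= m)%N ->
  (#|[set v in Ln L n | P v]%SET| <=
   #|[set U in Ln L (n + m) | P (window n i U)]%SET| + m)%N.
Proof.
move=> im; apply: leq_trans (card_le_preim (@window_deficiency n m i im) P) _.
by rewrite leq_add2l.
Qed.

(** Together with [window_count_le]: prolonging words by [m] letters changes a count by at most p(n
    + m) - p(n) + m, which is o(p(n)) under the complexity hypothesis. *)
Lemma window_count_ge n m i (P : pred (n.-tuple A)) : (i <= m)%N ->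
  (#|[set U in Ln L (n + m) | P (window n i U)]%SET| <=
   #|[set v in Ln L n | P v]%SET| + (p (n + m) - p n) + m)%N.
Proof.
move=> im; rewrite -(leq_add2r (p n)).
have := card_preim_le (window_sub n im) (@window_deficiency n m i im) P.
move=> /leq_trans; apply; rewrite -!/(complexity L _) -!addnA leq_add2l.
by move: (p (n + m)) (p n) (complexity_mono n m) => a b; lia.
Qed.

(** Right special words are the vertices of the Rauzy graph with out-degree at least two; left
    special words are, for n >= 1, those with in-degree at least two. *)
Definition right_special n (v : n.-tuple A) :=
  `[< exists a b, [/\ a <> b, L (rcons v a) & L (rcons v b)] >].
Definition left_special n (v : n.-tuple A) :=
  `[< exists a b, [/\ a <> b, L (a :: v) & L (b :: v)] >].

(** A special word has two preimages under the map that drops the last letter, for i = 0, or the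
    first one, for i = 1, so [card_multiple_fibres] applies with e = i. *)
Lemma card_special n i (S : pred (n.-tuple A)) : (i <= 1)%N ->
  (forall v, S v -> exists s t, [/\ s <> t, size s = (n + 1)%N /\ size t = (n + 1)%N,
     L s, L t & take n (drop i s) = v /\ take n (drop i t) = v]) ->
  (#|[set v in Ln L n | S v]%SET| <= p (n + 1) - p n + 1)%N.
Proof.
move=> i1 hS.
have := card_multiple_fibres (@window_sub n 1 i i1) (@window_deficiency n 1 i i1).
rewrite -!/(complexity _ _); set M := [set y in _ | _]%SET => cM.
suff : (#|[set v in Ln L n | S v]%SET| <= #|M|)%N by move: cM; lia.
apply: subset_leq_card; apply/fintype.subsetP => v; rewrite !inE => /andP[Lv].
rewrite Lv => /hS[s [t [st [ss sz] Ls Lt [sv tv]]]].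
apply/existsP; exists (tcast ss (in_tuple s)).
rewrite inE val_tcast; apply/andP; split; first exact/asboolP.
apply/existsP; exists (tcast sz (in_tuple t)).
rewrite inE val_tcast; apply/and4P; split.
- exact/asboolP.
- by apply/eqP => /(congr1 val); rewrite /= !val_tcast.
- by apply/eqP/val_inj; rewrite val_window ?val_tcast //; lia.
- by apply/eqP/val_inj; rewrite val_window ?val_tcast //; lia.
Qed.

Lemma card_right_special n :
  (#|[set v in Ln L n | right_special v]%SET| <= p (n + 1) - p n + 1)%N.
Proof.
apply: (@card_special _ 0) => // v /asboolP[a [b [ab La Lb]]].
exists (rcons v a), (rcons v b); split => //; rewrite ?size_rcons ?size_tuple ?addn1 //.
  by move/rcons_inj => -[].
by rewrite !drop0 -!cats1 !take_size_cat ?size_tuple.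
Qed.

Lemma card_left_special n :
  (#|[set v in Ln L n | left_special v]%SET| <= p (n + 1) - p n + 1)%N.
Proof.
apply: (@card_special _ 1) => // v /asboolP[a [b [ab La Lb]]].
exists (a :: v), (b :: v); split => //; rewrite /= ?size_tuple ?addn1 //.
  by case.
by rewrite drop0 take_oversize // size_tuple.
Qed.

(* If two windows at offsets i < j agree, the letters between them are
   forced by periodicity. *)
Lemma card_equal_windows n m i j : (i < j)%N -> (j <= m)%N ->
  (#|[set U in Ln L (n + m) | window n i U == window n j U]%SET| <= #|A| ^ m)%N.
Proof.
move=> ij jm; rewrite -card_tuple.
(* [g] keeps the [m] letters outside the window at offset [j]. Inside it, equality of the windows
   says that letter k equals letter k - j + i, so [U] is recovered by induction on k. *)
pose g (U : (n + m).-tuple A) : m.-tuple A :=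
  [tuple if (k < j)%N then nth a0 U k else nth a0 U (n + k) | k < m].
rewrite -(@card_in_imset _ _ g); first exact: max_card.
move=> U V; rewrite !inE => /andP[_ /eqP UW] /andP[_ /eqP VW] gUV.
have gk k : (k < m)%N -> (if (k < j)%N then nth a0 U k else nth a0 U (n + k)) =
    (if (k < j)%N then nth a0 V k else nth a0 V (n + k)).
  move=> km; have := congr1 (fun t => tnth t (Ordinal km)) gUV.
  by rewrite !tnth_mktuple.
apply: eq_from_tnth => k; rewrite !(tnth_nth a0).
have: (k < n + m)%N by [].
elim/ltn_ind: (nat_of_ord k) => {k}k IH kn.
case: (ltnP k j) => kj; first by have := gk k; rewrite kj; apply; lia.
case: (ltnP k (n + j)) => knj.
  have e1 := congr1 (fun t => nth a0 (tval t) (k - j)%N) UW.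
  have e2 := congr1 (fun t => nth a0 (tval t) (k - j)%N) VW.
  move: e1 e2; rewrite !nth_window; try lia.
  by rewrite !(subnKC kj) => <- <-; apply: IH; lia.
have := gk (k - n)%N; rewrite (_ : (k - n < j)%N = false); last by lia.
by rewrite subnKC; [apply; lia|lia].
Qed.

End Windows.

(** * Balls in Rauzy graphs *)

Section PathBalls.
Variables (A : finType) (r : nat) (w : nat -> A).

(** The [r]-ball of [v] is a directed path of 2r + 1 vertices with [v] in the middle, whose arcs
    carry the labels [w] at 0, ..., 2r - 1. *)
Definition path_ball (V : Type) (arc : V -> A -> V -> Prop) (v : V)
    (g : nat -> V) : Prop :=
  [/\ g r = v,
      {in [pred i | (i <= 2 * r)%N] &, injective g},
      forall x, Defs.within arc v r x <-> exists2 i, (i <= 2 * r)%N & g i = x &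
      forall i a j, (i <= 2 * r)%N -> (j <= 2 * r)%N ->
        (arc (g i) a (g j) <-> j = i.+1 /\ a = w i)].

(** Both balls are the same labelled path, so matching [g i] with [g' i] carries an isomorphism
    over. *)
Lemma ball_iso_path_transfer (V V' : Type) arc arc' (v : V) (v' : V') g g'
    k (H : 'I_k -> A -> 'I_k -> bool) o :
  path_ball arc v g -> path_ball arc' v' g' ->
  ball_iso arc v r H o -> ball_iso arc' v' r H o.
Proof.
move=> [gr ginj gW garc] [gr' ginj' gW' garc'] [f [finj fo fW farc]].
have hex i : exists j, (j <= 2 * r)%N /\ g j = f i.
  have [|j jr gj] := (gW (f i)).1; first by apply/fW; exists i.
  by exists j.
have [h hP] := choice hex.
have hinj : injective h.
  by move=> i j hij; apply: finj; rewrite -(hP i).2 -(hP j).2 hij.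
exists (fun i => g' (h i)); split.
- move=> i j /ginj' hij; apply: hinj; apply: hij; rewrite inE; exact: (hP _).1.
- rewrite -gr'; congr g'; apply: ginj; rewrite ?inE; first exact: (hP _).1.
    by rewrite leq_pmull.
  by rewrite (hP o).2 fo gr.
- move=> x; split=> [/gW'[j jr <-]|[i <-]]; last first.
    by apply/gW'; exists (h i) => //; exact: (hP i).1.
  have /fW[i fi] : Defs.within arc v r (g j) by apply/gW; exists j.
  exists i; congr g'; apply: ginj; rewrite ?inE //; first exact: (hP i).1.
  by rewrite (hP i).2.
- move=> i a j; rewrite (farc i a j) -(hP i).2 -(hP j).2.
  by rewrite garc ?garc' //; [exact: (hP i).1|exact: (hP j).1|exact: (hP i).1|exact: (hP j).1].
Qed.

(** With in- and out-degrees at most one, a search from [g r] moves only along the path, one step in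
    each direction per unit of radius. The vertex of index 2r + 1 lies outside the ball; it ensures
    that the arc leaving vertex 2r does not return to the path. *)
Lemma path_ball_of_degrees (V : Type) (arc : V -> A -> V -> Prop) (g : nat -> V) :
  {in [pred i | (i <= (2 * r).+1)%N] &, injective g} ->
  (forall i, (i < (2 * r).+1)%N -> arc (g i) (w i) (g i.+1)) ->
  (forall i a y b z, (i <= 2 * r)%N ->
     arc (g i) a y -> arc (g i) b z -> a = b /\ y = z) ->
  (forall i a y b z, (i <= 2 * r)%N ->
     arc y a (g i) -> arc z b (g i) -> y = z) ->
  path_ball arc (g r) g.
Proof.
move=> ginj garc gout gin; split => //.
- by move=> i j; rewrite !inE => ir jr; apply: ginj; rewrite inE; lia.
- suff W s x : (s <= r)%N -> (Defs.within arc (g r) s x <->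
      exists2 i, (r - s <= i <= r + s)%N & g i = x).
    move=> x; rewrite W // subnn.
    by split=> -[i ir gi]; exists i => //; lia.
  elim: s x => [|s IH] x sr.
    split=> [->|[i ir <-]] /=; first by exists r => //; lia.
    by congr g; lia.
  have {}IH y := IH y (ltnW sr).
  split=> /=.
    move=> [/IH[i ir <-]|[y [a [/IH[i ir <-] [ar|ar]]]]].
    + by exists i => //; lia.
    + have [||_ <-] := @gout i _ _ _ _ _ (garc i _) ar; try lia.
      by exists i.+1 => //; lia.
    + exists i.-1; first by lia.
      have := garc i.-1; rewrite prednK; last by lia.
      by move=> ga; apply: (@gin i _ _ _ _ _ _ ar); [lia|apply: ga; lia].
  move=> [i ir <-].
  have [lo|] := boolP (r - s <= i <= r + s)%N; first by left; apply/IH; exists i.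
  move=> nir; right.
  have [irs|ri] : i = (r - s).-1 \/ i = (r + s).+1 by lia.
    exists (g i.+1), (w i); split; last by right; apply: garc; lia.
    by apply/IH; exists i.+1 => //; lia.
  exists (g i.-1), (w i.-1); split; first by apply/IH; exists i.-1 => //; lia.
  by left; have := garc i.-1; rewrite prednK; [apply; lia|lia].
- move=> i a j ir jr; split=> [ar|[-> ->]]; last by apply: garc; lia.
  have [|aw gj] := @gout i _ _ _ _ ir ar (garc i _); first by lia.
  by split => //; apply: ginj => //; rewrite inE; lia.
Qed.

End PathBalls.

Section LineAndRauzy.
Variables (A : finType) (a0 : A) (L : seq A -> Prop).

Lemma line_path_ball r (x : int -> A) :
  path_ball r (fun i => x (i%:Z - r%:Z)%R) (line_arc x) 0%R
    (fun i => (i%:Z - r%:Z)%R).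
Proof.
rewrite [X in path_ball _ _ _ X](_ : 0%R = (r%:Z - r%:Z)%R); last by lia.
apply: (@path_ball_of_degrees _ r _ _ _ (fun i => (i%:Z - r%:Z)%R)).
- by move=> i j _ _ /=; lia.
- by move=> i _; split => //; lia.
- by move=> i a y b z _ [-> ->] [-> ->].
- by move=> i a y b z _ [yE _] [zE _]; lia.
Qed.

(** The 2r + 2 windows of [U] are the vertices of the path, and the arc out of window [i] carries
    the letter of [U] just after it. Absence of special windows bounds the degrees by one. *)
Lemma rauzy_path_ball n r (U : (n + (2 * r).+1).-tuple A) :
  extendable_language L -> L U ->
  (forall i, (i <= 2 * r)%N -> ~~ right_special L (window a0 n i U)) ->
  (forall i, (i <= 2 * r)%N -> ~~ left_special L (window a0 n i U)) ->
  (forall i j, (i < j)%N -> (j <= (2 * r).+1)%N ->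
     window a0 n i U != window a0 n j U) ->
  path_ball r (fun i => nth a0 U (n + i)) (@rauzy_arc A L n) (window a0 n r U)
    (fun i => window a0 n i U).
Proof.
move=> HL LU nR nL dist.
apply: (@path_ball_of_degrees _ r _ _ _ (fun i => window a0 n i U)).
- move=> i j; rewrite !inE => ir jr eij.
  by case: (ltngtP i j) => // ij; [have := dist _ _ ij jr|have := dist _ _ ij ir];
    rewrite eij eqxx.
- move=> i ir; have E : rcons (window a0 n i U) (nth a0 U (n + i)) =
      take n.+1 (drop i U).
    rewrite val_window; last by lia.
    rewrite -[nth a0 U (n + i)](_ : nth a0 (drop i U) n = _).
      by rewrite -take_nth // size_drop size_tuple; lia.
    by rewrite nth_drop; congr nth; lia.
  rewrite /rauzy_arc E; split.
    case: HL => _ fac _ _; apply: (fac (take i U) _ (drop n.+1 (drop i U))).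
    by rewrite !cat_take_drop.
  rewrite val_window; last by lia.
  apply: (@eq_from_nth _ a0).
    rewrite size_behead !size_takel ?size_drop ?size_tuple; lia.
  move=> j; rewrite size_take size_drop size_tuple => jn.
  have {}jn : (j < n)%N by move: jn; case: ifP; lia.
  by rewrite nth_behead !nth_take // !nth_drop; congr nth; lia.
- move=> i a y b z ir [La ya] [Lb yb].
  suff ab : a = b by split=> //; apply: val_inj; rewrite ya yb ab.
  apply: contrapT => nab; move/negP: (nR i ir); apply; apply/asboolP.
  by exists a, b.
- move=> i a y b z ir [La ya] [Lb yb].
  (* If an arc labelled [c] leads from [t] to a vertex, then [rcons t c] is that vertex preceded by
     one letter; two different predecessors would make the vertex left special. *)
  have hd (t : n.-tuple A) c : exists d, rcons t c = d :: behead (rcons t c).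
    by case: (rcons t c) (size_rcons t c) => // d s _; exists d.
  have [d dE] := hd y a; have [e eE] := hd z b.
  rewrite -ya in dE; rewrite -yb in eE.
  have de : d = e.
    apply: contrapT => nde; move/negP: (nL i ir); apply; apply/asboolP.
    by exists d, e; split => //; [rewrite dE in La|rewrite eE in Lb].
  by apply/val_inj; have /rcons_inj[] : rcons y a = rcons z b by rewrite dE eE de.
Qed.

End LineAndRauzy.

(** * Ball statistics of Rauzy graphs and suffix statistics of words *)

Section Count.
Variables (A : finType) (a0 : A) (L : seq A -> Prop).
Hypothesis HL : extendable_language L.
Local Notation p := (complexity L).

(** The word is placed from position -r on. Beyond its letters the absolute value and the default
    give arbitrary values, but the [r]-ball of 0 reads only the positions -r to r - 1. *)
Definition word_to_line r (w : seq A) : int -> A :=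
  fun i => nth a0 w `|(i + r%:Z)%R|%N.

(** A union bound over the windows: few words are special, and each pair of equal windows leaves at
    most |A|^(2r + 1) words, whatever [n] is. *)
Lemma card_irregular n r :
  (#|[set U in Ln L (n + (2 * r).+1) |
     [|| [exists i : 'I_(2 * r).+1, right_special L (window a0 n i U)],
         [exists i : 'I_(2 * r).+1, left_special L (window a0 n i U)] |
         [exists i : 'I_(2 * r).+2, [exists j : 'I_(2 * r).+2,
            (i < j)%N && (window a0 n i U == window a0 n j U)]]]]%SET|
   <= (4 * (2 * r).+1 * (2 * r).+2 + (2 * r).+2 * (2 * r).+2 * #|A| ^ (2 * r).+1)
      * (p (n + (2 * r).+1) - p n + 1))%N.
Proof.
set m := (2 * r).+1; set d := (p (n + m) - p n)%N.
have d1 : (p (n + 1) - p n <= d)%N.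
  by have := complexity_mono a0 HL (n + 1) m.-1; rewrite -addnA add1n /d /m /=; lia.
have cE (S : pred (n.-tuple A)) (i : 'I_m) :
    (#|[set v in Ln L n | S v]%SET| <= p (n + 1) - p n + 1)%N ->
    (#|[set U in Ln L (n + m) | S (window a0 n i U)]%SET| <= 2 * d + 1 + m)%N.
  move=> cS; have := @window_count_ge _ a0 _ HL n m i S (ltnW (ltn_ord i)).
  by rewrite -/d; lia.
set B1 := (\bigcup_(i < m) [set U in Ln L (n + m) | right_special L (window a0 n i U)])%SET.
set B2 := (\bigcup_(i < m) [set U in Ln L (n + m) | left_special L (window a0 n i U)])%SET.
set B3 := (\bigcup_(i < m.+1) \bigcup_(j < m.+1 | (i < j)%N)
   [set U in Ln L (n + m) | window a0 n i U == window a0 n j U])%SET.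
have bnd (I : finType) (T : finType) (P : pred I) (F : I -> {set T}) c :
    (forall i, P i -> (#|F i| <= c)%N) -> (#|\bigcup_(i | P i) F i| <= #|I| * c)%N.
  move=> Fc; apply: (@leq_trans (\sum_(i | P i) c)).
    apply: (big_ind2 (fun (X : {set T}) k => (#|X| <= k)%N)) => //; first by rewrite cards0.
    move=> X k Y l Xk Yl; rewrite cardsU; lia.
  by rewrite sum_nat_const leq_mul2r max_card orbT.
have c1 : (#|B1| <= m * (2 * d + 1 + m))%N.
  rewrite -[X in (_ <= X * _)%N]card_ord; apply: bnd => i _.
  by apply: cE; exact: card_right_special.
have c2 : (#|B2| <= m * (2 * d + 1 + m))%N.
  rewrite -[X in (_ <= X * _)%N]card_ord; apply: bnd => i _.
  by apply: cE; exact: card_left_special.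
have c3 : (#|B3| <= m.+1 * (m.+1 * #|A| ^ m))%N.
  rewrite -[X in (_ <= X * _)%N](card_ord m.+1); apply: (bnd) => i _.
  rewrite -[X in (_ <= X * _)%N](card_ord m.+1); apply: (bnd) => j ij.
  by apply: card_equal_windows => //; rewrite -ltnS.
apply: (@leq_trans #|B1 :|: B2 :|: B3|).
  apply: subset_leq_card; apply/fintype.subsetP => U.
  rewrite inE => /andP[LU]; rewrite !finset.in_setU => /or3P[/existsP[i hi]|/existsP[i hi]|].
  - by apply/orP; left; apply/orP; left; apply/bigcupP; exists i => //; rewrite inE LU.
  - by apply/orP; left; apply/orP; right; apply/bigcupP; exists i => //; rewrite inE LU.
  - move=> /existsP[i /existsP[j /andP[ij eij]]]; apply/orP; right.
    by apply/bigcupP; exists i => //; apply/bigcupP; exists j => //; rewrite inE LU.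
(* The constant comes from 2d + 1 + m <= 2(m + 1)(d + 1), used for [m] right and [m] left special
   windows, plus at most (m + 1)^2 pairs of equal windows. *)
have := cardsU (B1 :|: B2) B3; have := cardsU B1 B2.
move: c1 c2 c3; rewrite -[(2 * r).+2]/m.+1; set K := (#|A| ^ m)%N; nia.
Qed.

(** Counting vertices is replaced by counting words [U] that have the vertex as window at offset
    [r]. Unless [U] is irregular, the ball of the vertex is a path whose labels are read in the last
    2r + 1 letters of [U], like the ball of a line. *)
Lemma rauzy_ball_count r k (H : 'I_k -> A -> 'I_k -> bool) (o : 'I_k) :
  exists K, forall n,
    let B := #|[set v in Ln L n | `[< ball_iso (@rauzy_arc A L n) v r H o >]]%SET| in
    let D := #|[set U in Ln L (n + (2 * r).+1) |
       `[< ball_iso (line_arc (word_to_line r (drop n U))) 0%R r H o >] ]%SET| in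
    (B <= D + K * (p (n + (2 * r).+1) - p n + 1) /\
     D <= B + K * (p (n + (2 * r).+1) - p n + 1))%N.
Proof.
set m := (2 * r).+1.
set K := (4 * (2 * r).+1 * (2 * r).+2 + (2 * r).+2 * (2 * r).+2 * #|A| ^ (2 * r).+1)%N.
(* [K] pays for the irregular words, and m + 1 for the passage between vertices and words, which
   costs at most d + m. *)
exists (K + m + 1)%N => n B D.
have := card_irregular n r; rewrite -/K -/m; set d := (p (n + m) - p n)%N.
set I := [set U in _ | _]%SET => cI.
pose C := [set U in Ln L (n + m) |
   `[< ball_iso (@rauzy_arc A L n) (window a0 n r U) r H o >] ]%SET.
have rm : (r <= m)%N by rewrite /m; lia.
have c1 := @window_count_le _ a0 _ HL n m r
  (fun v => `[< ball_iso (@rauzy_arc A L n) v r H o >]) rm.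
have c2 := @window_count_ge _ a0 _ HL n m r
  (fun v => `[< ball_iso (@rauzy_arc A L n) v r H o >]) rm.
rewrite -/B -/d -/C in c1 c2.
have eqv U : U \in Ln L (n + m) -> U \notin I ->
    (ball_iso (@rauzy_arc A L n) (window a0 n r U) r H o <->
     ball_iso (line_arc (word_to_line r (drop n U))) 0%R r H o).
  move=> UL; rewrite inE UL /= !negb_or => /and3P[/existsPn n1 /existsPn n2 /existsPn n3].
  have pr : path_ball r (fun i => nth a0 U (n + i)) (@rauzy_arc A L n)
      (window a0 n r U) (fun i => window a0 n i U).
    apply: rauzy_path_ball => //.
    - by apply/asboolP; rewrite -mem_Ln.
    - by move=> i; rewrite -ltnS => ir; exact: (n1 (Ordinal ir)).
    - by move=> i; rewrite -ltnS => ir; exact: (n2 (Ordinal ir)).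
    - move=> i j ij jr; have ir : (i < (2 * r).+2)%N by lia.
      have := n3 (Ordinal ir); rewrite -ltnS in jr.
      by move=> /existsPn /(_ (Ordinal jr)); rewrite /= ij.
  have pl := line_path_ball r (word_to_line r (drop n U)).
  have E : (fun i : nat => word_to_line r (drop n U) (i%:Z - r%:Z)%R) =
      (fun i => nth a0 U (n + i)).
    by apply/funext => i; rewrite /word_to_line subrK absz_nat nth_drop.
  rewrite E in pl.
  by split; [exact: ball_iso_path_transfer pr pl|exact: ball_iso_path_transfer pl pr].
have cU (Z Y : {set (n + m).-tuple A}) :
    (forall U, U \in Z -> U \notin I -> U \in Y) -> (#|Z| <= #|Y| + #|I|)%N.
  move=> ZY; rewrite (leq_trans (subset_leq_card (_ : Z \subset Y :|: I))) //.
    apply/fintype.subsetP => U UZ; rewrite finset.in_setU.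
    by case: (boolP (U \in I)) => [|/(ZY _ UZ) ->]; rewrite ?orbT.
  by rewrite cardsU leq_subr.
have sCD : (#|C| <= D + #|I|)%N.
  apply: cU => U; rewrite [U \in C]finset.in_set => /andP[UL /asboolP bU] /(eqv _ UL) e.
  by rewrite finset.in_set UL; apply/asboolP/e.
have sDC : (D <= #|C| + #|I|)%N.
  apply: cU => U; rewrite finset.in_set => /andP[UL /asboolP bU] /(eqv _ UL) e.
  by rewrite [U \in C]finset.in_set UL; apply/asboolP/e.
by move: #|I| #|C| B D cI c1 c2 sCD sDC => i c b d'; nia.
Qed.

End Count.

(** * A random sequence with prescribed law *)

Section ProbabilityFacts.
Context (R : realType) d (T : measurableType d).

Lemma measure_partition (mu : {measure set T -> \bar R}%R) (I : finType) (f : T -> I) (B : set T) :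
  measurable B -> (forall i, measurable [set x | f x = i]) ->
  mu B = (\sum_i mu (B `&` [set x | f x = i]))%E.
Proof.
move=> mB mf.
have mfs (s : seq I) : measurable [set x | f x \in s].
  elim: s => [|i s IH]; first by rewrite (_ : [set _ | _] = set0) //; apply/seteqP; split.
  rewrite (_ : [set _ | _] = [set x | f x = i] `|` [set x | f x \in s]).
    exact: measurableU.
  apply/seteqP; split=> x /=; rewrite inE.
    by move=> /orP[/eqP ->|]; [left|right].
  by move=> [->|->]; rewrite ?eqxx ?orbT.
suff H (s : seq I) : uniq s ->
    mu (B `&` [set x | f x \in s]) = (\sum_(i <- s) mu (B `&` [set x | f x = i]))%E.
  rewrite -big_enum -H ?enum_uniq //; congr (mu _).
  by apply/seteqP; split=> [x Bx|x []//]; split => //=; rewrite mem_enum.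
elim: s => [_|i s IH /= /andP[nis us]].
  rewrite big_nil (_ : _ `&` _ = set0) ?measure0 //.
  by apply/seteqP; split => // x [].
rewrite big_cons -IH // -measureU; [|exact: measurableI|exact: measurableI|].
  congr (mu _); apply/seteqP; split=> x /=.
    by rewrite inE => -[Bx /orP[/eqP fx|fx]]; [left|right].
  by move=> [] [Bx fx]; split => //; rewrite inE fx ?eqxx ?orbT.
apply/seteqP; split=> // x [[_ /= fx] [_ /= fxs]].
by rewrite -fx fxs in nis.
Qed.

Lemma probability_pushforward d' (T' : measurableType d') (P : probability T R)
    (f : T -> T') : measurable_fun setT f ->
  exists Q : probability T' R, forall B, Q B = P (f @^-1` B).
Proof.
move=> mf; pose X : {mfun T >-> T'} := HB.pack f (isMeasurableFun.Build _ _ _ _ f mf).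
by exists (distribution P X).
Qed.

End ProbabilityFacts.

Section NestedIntervals.
Variables (R : realType) (A : finType) (a0 : A) (q : seq A -> R).
Hypothesis q1 : q [::] = 1%R.
Hypothesis q_ge0 : forall v, (0 <= q v)%R.
Hypothesis q_cons : forall v, q v = (\sum_a q (a :: v))%R.

(** Words carry their newest letter at the head, so the children of [v] are the words [b :: v].
    Their intervals are laid side by side in the order of [enum_rank]. *)
Definition offset (v : seq A) (k : nat) : R :=
  (\sum_(b | (enum_rank b < k)%N) q (b :: v))%R.

Fixpoint left_end (v : seq A) : R :=
  if v is a :: v' then (left_end v' + offset v' (enum_rank a))%R else 0%R.

(** Half-open, so that the children of a slot partition it exactly; words of zero weight get the
    empty set. *)
Definition slot (v : seq A) : set R := `[left_end v, (left_end v + q v)%R[%classic.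

Lemma offsetS v (a : A) :
  offset v (enum_rank a).+1 = (offset v (enum_rank a) + q (a :: v))%R.
Proof.
rewrite /offset (bigD1 a) /=; last by rewrite ltnS.
rewrite addrC; congr (_ + _)%R; apply: eq_bigl => b.
rewrite ltnS leq_eqVlt andb_orl.
rewrite -(inj_eq enum_rank_inj b a) -[enum_rank b == _]/(_ == _ :> nat).
by case: ltngtP.
Qed.

Lemma offset_le v k l : (k <= l)%N -> (offset v k <= offset v l)%R.
Proof.
move=> kl; rewrite /offset [leRHS](bigID (fun b => (enum_rank b < k)%N)) /=.
rewrite [X in (_ <= X + _)%R](eq_bigl (fun b => (enum_rank b < k)%N)).
  by rewrite lerDl sumr_ge0.
by move=> b; rewrite andb_idl // => /leq_trans; apply.
Qed.

Lemma offset_max v : offset v #|A| = q v.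
Proof. by rewrite q_cons /offset; apply: eq_bigl => b; rewrite ltn_ord. Qed.

Lemma slot_cons v a t : slot (a :: v) t <->
  (left_end v + offset v (enum_rank a) <= t <
   left_end v + offset v (enum_rank a).+1)%R.
Proof. by rewrite /slot /= in_itv /= offsetS addrA. Qed.

Lemma slot_parent v a t : slot (a :: v) t -> slot v t.
Proof.
move=> /slot_cons /andP[lo hi]; rewrite /slot /= in_itv /=.
have := @offset_le v 0 (enum_rank a) (leq0n _).
rewrite {1}/offset big_pred0 // => o0.
have := @offset_le v (enum_rank a).+1 #|A| (ltn_ord _).
rewrite offset_max => o1; apply/andP; split; lra.
Qed.

(** Descending from the last child, the first one whose left end does not exceed [t] contains it. *)
Lemma slot_child v t : slot v t -> exists a, slot (a :: v) t.
Proof.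
rewrite {1}/slot /= in_itv /= -offset_max => /andP[lo].
have : (#|A| <= #|A|)%N by [].
elim: {1 3}#|A| => [_|k IH kA hi].
  by rewrite /offset big_pred0 // addr0 ltNge lo.
have [hk|hk] := ltP t (left_end v + offset v k)%R; first by apply: IH => //; exact: ltnW.
exists (enum_val (Ordinal kA)); apply/slot_cons.
by rewrite enum_valK hk.
Qed.

Lemma slot_inj v a b t : slot (a :: v) t -> slot (b :: v) t -> a = b.
Proof.
move=> /slot_cons /andP[loa hia] /slot_cons /andP[lob hib].
case: (ssrnat.ltngtP (enum_rank a) (enum_rank b)) => [ab|ba|/val_inj/enum_rank_inj//].
  by exfalso; move: ab => /(@offset_le v); lra.
by exfalso; move: ba => /(@offset_le v); lra.
Qed.

(* Points outside [0, 1[ lie in no slot and get the junk letter [a0]. *)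
Definition next_letter (v : seq A) (t : R) : A :=
  odflt a0 [pick a | `[< slot (a :: v) t >]].

Fixpoint address (n : nat) (t : R) : seq A :=
  if n is n'.+1 then next_letter (address n' t) t :: address n' t else [::].

Lemma size_address n t : size (address n t) = n.
Proof. by elim: n => //= n ->. Qed.

Lemma addressE n t :
  address n t = rev (mkseq (fun k => next_letter (address k t) t) n).
Proof. by elim: n => //= n IH; rewrite mkseqS rev_rcons -IH. Qed.

Lemma next_letter_slot v t a : slot (a :: v) t -> next_letter v t = a.
Proof.
move=> sa; rewrite /next_letter; case: pickP => [b /asboolP sb|/(_ a)].
  exact: slot_inj sb sa.
by move/asboolP.
Qed.

Lemma slot_address v t : slot v t -> address (size v) t = v.
Proof.
elim: v => //= a v IH sa.
by rewrite (IH (slot_parent sa)) (next_letter_slot sa).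
Qed.

Lemma address_slot n t : slot [::] t -> slot (address n t) t.
Proof.
move=> t01; elim: n => //= n /slot_child[a sa].
by rewrite (next_letter_slot sa).
Qed.

Lemma address_out n t : ~ slot [::] t -> address n t = nseq n a0.
Proof.
move=> nt; elim: n => //= n ->; congr cons.
rewrite /next_letter; case: pickP => // a /asboolP sa; exfalso; apply: nt.
elim: (nseq n a0) a sa => [a /slot_parent//|b v IH a /slot_parent/IH//].
Qed.

Lemma address_fiber v : [set t | address (size v) t = v] `&` slot [::] = slot v.
Proof.
apply/seteqP; split=> [t [/= <- t01]|t sv]; first exact: address_slot.
split; first exact: slot_address.
by elim: v sv => // a v IH /slot_parent.
Qed.

Lemma measurable_slot v : measurable (slot v : set (measurableTypeR R)).
Proof. exact: measurable_itv. Qed.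

(** Outside the slot of the empty word the address is a constant junk word, so a fibre is a slot,
    possibly together with that whole outside. *)
Lemma measurable_address v :
  measurable ([set t | address (size v) t = v] : set (measurableTypeR R)).
Proof.
have -> : [set t | address (size v) t = v] =
    slot v `|` (if v == nseq (size v) a0 then ~` slot [::] else set0).
  rewrite -address_fiber; apply/seteqP; split=> t /=.
    have [t01|nt] := pselect (slot [::] t); first by left.
    by move=> av; right; rewrite -{1}av (address_out _ nt) eqxx.
  by case=> [[]//|]; case: eqP => // -> /address_out ->; rewrite size_nseq.
apply: measurableU; first exact: measurable_slot.
by case: ifP => _; [apply: measurableC; exact: measurable_slot|exact: measurable0].
Qed.

(** Under Lebesgue measure on [0, 1[ the slot of v has mass [q v], and it consists of the points
    with address v. Addresses list the newest letter first, whence the reversal. *)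
Lemma random_sequence : exists (P : probability (measurableTypeR R) R)
    (Y : measurableTypeR R -> nat -> A),
  (forall k a, measurable [set t | Y t k = a]) /\
  forall (y : nat -> A) n,
    P [set t | forall k, (k < n)%N -> Y t k = y k] = (q (rev (mkseq y n)))%:E.
Proof.
pose mu : {measure set (measurableTypeR R) -> \bar R}%R :=
  mrestr (@lebesgue_measure R) (measurable_slot [::]).
have slotE v : (@lebesgue_measure R) (slot v) = (q v)%:E.
  rewrite /slot lebesgue_measure_itv /= lte_fin ltrDl.
  case: ltP => [_|qv]; first by rewrite -EFinD addrAC subrr add0r.
  by congr EFin; apply/eqP; rewrite eq_le qv q_ge0.
have mu1 : mu setT = 1%E by rewrite /mu /= /mrestr setTI slotE q1.
pose P : probability (measurableTypeR R) R :=
  HB.pack (Measure.sort mu) (Measure_isProbability.Build _ _ _ (Measure.sort mu) mu1).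
exists P, (fun t k => next_letter (address k t) t); split.
  move=> k a; have -> : [set t | next_letter (address k t) t = a] =
     \bigcup_(v : k.-tuple A) [set t | address (size (a :: v)) t = a :: v].
    apply/seteqP; split=> t /=.
      move=> ta; exists (tcast (size_address k t) (in_tuple (address k t))) => //=.
      by rewrite val_tcast /= size_address ta.
    by move=> [v _]; rewrite size_tuple => -[].
  apply: countable_bigcupT_measurable; first exact: countableP.
  by move=> v; exact: measurable_address.
move=> y n; rewrite -slotE -address_fiber /= /mrestr; congr (_ (_ `&` _)).
apply/seteqP; split=> t /=; rewrite size_rev size_mkseq addressE.
  by move=> ty; congr rev; apply: (@eq_from_nth _ a0);
    rewrite !size_mkseq // => k kn; rewrite !nth_mkseq // ty.
move=> /(can_inj revK) ty k kn.
by have := congr1 (nth a0 ^~ k) ty; rewrite /= !nth_mkseq.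
Qed.

End NestedIntervals.

(** * Shift-invariant measures on two-sided sequences *)

Section Cylinders.
Variables (A : finType) (a0 : A).

Definition block (x : int -> A) (i : int) (n : nat) : seq A :=
  mkseq (fun j => x (i + j%:Z)%R) n.

Lemma blockS x i n : block x i n.+1 = rcons (block x i n) (x (i + n%:Z)%R).
Proof. exact: mkseqS. Qed.

Lemma size_block x i n : size (block x i n) = n.
Proof. exact: size_mkseq. Qed.

Lemma nth_block x i n j : (j < n)%N -> nth a0 (block x i n) j = x (i + j%:Z)%R.
Proof. exact: nth_mkseq. Qed.

Lemma block_cons x i n : block x i n.+1 = x i :: block x (i + 1)%R n.
Proof.
apply: (@eq_from_nth _ a0) => [|j]; first by rewrite size_block /= size_block.
rewrite size_block => jn; rewrite nth_block //.
case: j jn => [|j] jn /=; first by rewrite addr0.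
by rewrite nth_block //; congr x; lia.
Qed.

Definition cylinder (i : int) (w : seq A) : set (SpZ a0) :=
  [set x | block x i (size w) = w].

Lemma measurable_letter i (a : A) : measurable [set x : SpZ a0 | x i = a].
Proof. by apply: sub_sigma_algebra; exists i, a. Qed.

Lemma cylinder_rcons i w a :
  cylinder i (rcons w a) = cylinder i w `&` [set x | x (i + (size w)%:Z)%R = a].
Proof.
apply/seteqP; split=> x; rewrite /cylinder /= size_rcons blockS.
  by move/rcons_inj => -[-> ->].
by move=> [-> ->].
Qed.

Lemma cylinder_cons i w a :
  cylinder i (a :: w) = cylinder (i + 1)%R w `&` [set x | x i = a].
Proof.
by apply/seteqP; split=> x; rewrite /cylinder /= block_cons; [case|move=> [-> ->]].
Qed.

Lemma measurable_cylinder i w : measurable (cylinder i w).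
Proof.
elim/last_ind: w => [|w a IH].
  by rewrite (_ : cylinder _ _ = setT) //; apply/seteqP; split.
by rewrite cylinder_rcons; apply: measurableI => //; exact: measurable_letter.
Qed.

Lemma measurable_block i n (P : seq A -> Prop) :
  measurable [set x : SpZ a0 | P (block x i n)].
Proof.
have -> : [set x : SpZ a0 | P (block x i n)] = \bigcup_(w : seq A)
    (if `[< P w /\ size w = n >] then cylinder i w else set0).
  apply/seteqP; split=> [x Px|x [w _]].
    exists (block x i n) => //; case: asboolP => [_|[]]; last by rewrite size_block.
    by rewrite /cylinder /= size_block.
  by case: asboolP => [[Pw <-]|]; rewrite /cylinder //= => ->.
apply: countable_bigcupT_measurable; first exact: countableP.
by move=> w; case: ifP => _ //; exact: measurable_cylinder.
Qed.

(** Cylinders over the intervals [-n, n[. Any two of them are nested or disjoint, so adding the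
    empty set gives a pi-system. *)
Definition centered_cylinders : set (set (SpZ a0)) :=
  [set B | B = set0 \/ exists2 w, odd (size w) = false &
     B = cylinder (- (size w)./2%:Z)%R w].

Lemma centered_setI_closed : setI_closed centered_cylinders.
Proof.
have main v w : odd (size v) = false -> odd (size w) = false ->
    (size v <= size w)%N -> centered_cylinders
      (cylinder (- (size v)./2%:Z)%R v `&` cylinder (- (size w)./2%:Z)%R w).
  move=> ov ow vw.
  have [[x [xv xw]]|nx] := pselect (exists x,
      (cylinder (- (size v)./2%:Z)%R v `&` cylinder (- (size w)./2%:Z)%R w) x).
    right; exists w => //; apply/seteqP; split=> [y []//|y yw]; split => //.
    rewrite /cylinder /= -{}xv /= in xw yw *.
    rewrite size_block; apply: (@eq_from_nth _ a0); rewrite !size_block // => j jv.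
    rewrite !nth_block //.
    (* The index in [w] of the position held by letter [j] of [v]. *)
    pose k := (j + (size w)./2 - (size v)./2)%N.
    have kE : (- (size v)./2%:Z + j%:Z = - (size w)./2%:Z + k%:Z :> int)%R by lia.
    have kw : (k < size w)%N by lia.
    by rewrite kE -(nth_block y _ kw) yw -[in LHS]xw nth_block.
  by left; apply/seteqP; split=> // x vwx; apply: nx; exists x.
move=> B C [->|[v ov ->]]; first by rewrite set0I; left.
move=> [->|[w ow ->]]; first by rewrite setI0; left.
by case: (leqP (size v) (size w)) => [|/ltnW] vw; [|rewrite setIC]; exact: main.
Qed.

Lemma centered_generate :
  @measurable _ (SpZ a0) = <<s centered_cylinders >>.
Proof.
apply/seteqP; split.
  apply: smallest_sub; first exact: smallest_sigma_algebra.
  move=> _ [i [a ->]]; pose n := (`|i|%N + 1)%N.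
  have -> : [set x : spZ a0 | x i = a] = \bigcup_(w : seq A)
      (if `[< size w = n.*2 /\ nth a0 w `|(i + n%:Z)%R| = a >]
       then cylinder (- n%:Z)%R w else set0).
    have iE : (i = - n%:Z + `|(i + n%:Z)%R|%:Z :> int)%R by rewrite /n; lia.
    have lt : (`|(i + n%:Z)%R| < n.*2)%N by rewrite /n; lia.
    apply/seteqP; split=> [x xi|x [w _]].
      exists (block x (- n%:Z)%R n.*2) => //.
      case: asboolP => [_|[]]; first by rewrite /cylinder /= size_block.
      by rewrite size_block nth_block // -iE.
    case: asboolP => // -[sw <-]; rewrite /cylinder /= sw => xw.
    by rewrite -xw nth_block // -iE.
  apply: (@countable_bigcupT_measurable _ (g_sigma_algebraType centered_cylinders)).
    exact: countableP.
  move=> w; case: asboolP => // -[sw _]; apply: sub_sigma_algebra.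
  by right; exists w; rewrite sw ?odd_double ?doubleK.
apply: smallest_sub; first exact: sigma_algebra_measurable.
by move=> B [->|[w _ ->]]; [exact: measurable0|exact: measurable_cylinder].
Qed.

Lemma cylinder_measure_unique (R : realType) (mu nu : probability (SpZ a0) R) :
  (forall i w, mu (cylinder i w) = nu (cylinder i w)) ->
  forall B, measurable B -> mu B = nu B.
Proof.
move=> munu; apply: (measure_unique centered_cylinders (fun=> setT)).
- exact: centered_generate.
- exact: centered_setI_closed.
- by move=> _; right; exists [::] => //; apply/seteqP; split.
- by apply/seteqP; split=> // x _; exists 0%N.
- by move=> B [->|[w _ ->]]; [rewrite !measure0|exact: munu].
- by move=> _; apply: (@le_lt_trans _ _ 1%E); [exact: probability_le1|exact: ltry].
Qed.

Lemma measurable_shiftZ : measurable_fun setT (@shiftZ A a0).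
Proof.
apply: (@measurability _ _ _ (SpZ a0) setT _ (@cylZ A a0)) => // _ [_ [i [a ->]] <-].
rewrite setTI; exact: measurable_letter (i + 1)%R a.
Qed.

Lemma cylinder_sum_rcons (R : realType) (mu : probability (SpZ a0) R) i w :
  mu (cylinder i w) = (\sum_a mu (cylinder i (rcons w a)))%E.
Proof.
rewrite (measure_partition mu (f := fun x : SpZ a0 => x (i + (size w)%:Z)%R)).
- by apply: eq_bigr => a _; rewrite cylinder_rcons.
- exact: measurable_cylinder.
- by move=> a; exact: measurable_letter.
Qed.

Lemma cylinder_sum_cons (R : realType) (mu : probability (SpZ a0) R) i w :
  mu (cylinder (i + 1)%R w) = (\sum_a mu (cylinder i (a :: w)))%E.
Proof.
rewrite (measure_partition mu (f := fun x : SpZ a0 => x i)).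
- by apply: eq_bigr => a _; rewrite cylinder_cons.
- exact: measurable_cylinder.
- by move=> a; exact: measurable_letter.
Qed.

Lemma shift_cylinder i w :
  (@shiftZ A a0) @^-1` cylinder i w = cylinder (i + 1)%R w.
Proof.
have E x : block (shiftZ x) i (size w) = block x (i + 1)%R (size w).
  by apply: eq_mkseq => j; rewrite /shiftZ addrAC.
by apply/seteqP; split=> x; rewrite /cylinder /= E.
Qed.

Lemma shift_invariant_of_cylinders (R : realType) (mu : probability (SpZ a0) R) :
  (forall i w, mu (cylinder (i + 1)%R w) = mu (cylinder i w)) ->
  shift_invariant (@shiftZ A a0) mu.
Proof.
move=> mui B mB; have [nu nuE] := probability_pushforward mu measurable_shiftZ.
rewrite -nuE; apply: cylinder_measure_unique mB => i w.
by rewrite nuE shift_cylinder.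
Qed.

Lemma shift_invariant_cylinder (R : realType) (mu : probability (SpZ a0) R) i w :
  shift_invariant (@shiftZ A a0) mu -> mu (cylinder i w) = mu (cylinder 0%R w).
Proof.
move=> mui.
have S j : mu (cylinder (j + 1)%R w) = mu (cylinder j w).
  by rewrite -shift_cylinder mui //; exact: measurable_cylinder.
case: i => n.
  by elim: n => // n IH; rewrite -IH -[RHS]S; congr (mu (cylinder _ w)); lia.
elim: n => [|n IH]; first by rewrite -(S (Negz 0)); congr (mu (cylinder _ w)); lia.
by rewrite -IH -(S (Negz n.+1)); congr (mu (cylinder _ w)); lia.
Qed.

End Cylinders.

(** * Two-sided Kolmogorov extension *)

Section Kolmogorov.
Variables (R : realType) (A : finType) (a0 : A) (q : seq A -> R).
Hypothesis q1 : q [::] = 1%R.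
Hypothesis q_ge0 : forall v, (0 <= q v)%R.
Hypothesis q_cons : forall v, q v = (\sum_a q (a :: v))%R.
Hypothesis q_rcons : forall v, q v = (\sum_a q (rcons v a))%R.

(* Centered words are read off from a sequence by adding letters alternately
   on the right and on the left. *)
Fixpoint arrange (v : seq A) : seq A :=
  if v is a :: v' then
    if odd (size v') then a :: arrange v' else rcons (arrange v') a
  else [::].

(** Enumerates the integers as 0, -1, 1, -2, 2, ..., the order in which [arrange] places letters. *)
Definition position (k : nat) : int := if odd k then Negz k./2 else Posz k./2.
Definition rank (i : int) : nat :=
  match i with Posz n => n.*2 | Negz n => n.*2.+1 end.

Lemma positionK : cancel rank position.
Proof.
case=> n; rewrite /position /=; first by rewrite odd_double doubleK.
by rewrite odd_double /= uphalf_double.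
Qed.

Lemma rank_position k : rank (position k) = k.
Proof. by rewrite /position; case: ifP => ok /=; lia. Qed.

Lemma arrange_block (x : int -> A) k :
  arrange (rev (mkseq (x \o position) k)) = block x (- k./2%:Z)%R k.
Proof.
elim: k => // k IH; rewrite mkseqS rev_rcons /= size_rev size_mkseq IH.
rewrite /position; case: ifP => ok /=.
  rewrite (block_cons a0) uphalf_half ok; congr (x _ :: block x _ _); lia.
rewrite blockS uphalf_half ok add0n; congr (rcons _ (x _)); lia.
Qed.

(** The weights [q \o arrange] are consistent under adding a newest letter, by [q_cons] or [q_rcons]
    according to parity. The random sequence with these weights, read along [rank], has the desired
    law. *)
Lemma exists_centered_law : exists mu : probability (SpZ a0) R,
  forall w, odd (size w) = false ->
    mu (cylinder (- (size w)./2%:Z)%R w) = (q w)%:E.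
Proof.
have [||P [Y [mY PY]]] := @random_sequence R A a0 (q \o arrange) q1.
- by move=> v; exact: q_ge0.
- by move=> v /=; case: (odd (size v)); [exact: q_cons|exact: q_rcons].
pose X (t : measurableTypeR R) : SpZ a0 := Y t \o rank.
have mX : measurable_fun setT X.
  apply: (@measurability _ _ _ (SpZ a0) setT _ (@cylZ A a0)) => // _ [_ [i [a ->]] <-].
  by rewrite setTI; exact: mY.
have [mu muE] := probability_pushforward P mX; exists mu => w ow.
pose x : int -> A := fun i => nth a0 w `|(i + (size w)./2%:Z)%R|.
have xw : block x (- (size w)./2%:Z)%R (size w) = w.
  apply: (@eq_from_nth _ a0); rewrite size_block // => j jw.
  by rewrite nth_block // /x; congr nth; lia.
rewrite muE -[in RHS]xw -arrange_block -PY; congr (P _).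
apply/seteqP; split=> t; rewrite /cylinder /=.
  move=> tw k kw.
  have xX m : (m < size w)%N -> nth a0 w m = X t (- (size w)./2%:Z + m%:Z)%R.
    by move=> mw; rewrite -[in LHS]tw nth_block.
  rewrite /x xX; last by rewrite /position; case: ifP; lia.
  rewrite /X /= -[in LHS](rank_position k); congr (Y t (rank _)).
  by rewrite /position; case: ifP; lia.
move=> ty; rewrite -[RHS]xw; apply: (@eq_from_nth _ a0); rewrite !size_block // => j jw.
rewrite !nth_block // /X /= ty ?positionK //.
by rewrite /rank; case iE: (_ + _)%R => [n|n]; lia.
Qed.

(** Every cylinder is a finite disjoint union of cylinders over one large centred interval; the two
    consistency rules sum their values back to [q w], which does not depend on the position. *)
Lemma exists_shift_invariant_law : exists mu : probability (SpZ a0) R,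
  shift_invariant (@shiftZ A a0) mu /\
  forall i w, mu (cylinder i w) = (q w)%:E.
Proof.
have [mu muw] := exists_centered_law; exists mu.
suff H : forall i w, mu (cylinder i w) = (q w)%:E.
  by split => //; apply: shift_invariant_of_cylinders => i w; rewrite !H.
have down i k : (forall w, size w = k.+1 -> mu (cylinder i w) = (q w)%:E) ->
    (forall w, size w = k -> mu (cylinder i w) = (q w)%:E) /\
    (forall w, size w = k -> mu (cylinder (i + 1)%R w) = (q w)%:E).
  move=> Hk; split=> w wk.
    rewrite cylinder_sum_rcons q_rcons -sumEFin; apply: eq_bigr => a _.
    by rewrite Hk // size_rcons wk.
  rewrite cylinder_sum_cons q_cons -sumEFin; apply: eq_bigr => a _.
  by rewrite Hk //= wk.
have downr l i k : (forall w, size w = (k + l)%N -> mu (cylinder i w) = (q w)%:E) ->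
    forall w, size w = k -> mu (cylinder i w) = (q w)%:E.
  elim: l => [|l IH]; first by rewrite addn0.
  by rewrite addnS => /down[/IH].
have downl l i k : (forall w, size w = (k + l)%N -> mu (cylinder i w) = (q w)%:E) ->
    forall w, size w = k -> mu (cylinder (i + l%:Z)%R w) = (q w)%:E.
  elim: l i => [|l IH] i; first by rewrite addn0 addr0.
  rewrite addnS => /down[_ /IH H] w /H <-.
  by congr (mu (cylinder _ w)); lia.
(* The interval [-n, n[ contains that of [w], with [l1] further letters on the left and [l2] on the
   right. *)
move=> i w; pose n := (`|i| + size w)%N.
have [l1 l1E] : exists l1 : nat, (i = - n%:Z + l1%:Z)%R by exists `|(i + n%:Z)%R|%N; lia.
have [l2 l2E] : exists l2, (size w + l2 + l1 = n.*2)%N by exists (n.*2 - size w - l1)%N; lia.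
rewrite l1E; apply: (downl l1 _ (size w)) => //; apply: (downr l2) => v vn.
have vs : size v = n.*2 by lia.
by rewrite -muw vs ?odd_double // doubleK.
Qed.

End Kolmogorov.

(** * Limits of word frequencies *)

Section UltrafilterLimits.
Context (R : realType) {T : Type} (F : set_system T).

Lemma cvg_bigsum {FF : Filter F} (I : Type) (s : seq I) (P : pred I)
    (f : I -> T -> R) (l : I -> R) :
  (forall i, f i @ F --> l i) ->
  (fun x => \sum_(i <- s | P i) f i x)%R @ F --> (\sum_(i <- s | P i) l i)%R.
Proof.
move=> fl; elim: s => [|i s IH].
  rewrite big_nil; under eq_fun do rewrite big_nil; exact: cvg_cst.
rewrite big_cons; under eq_fun do rewrite big_cons.
by case: (P i) => //; apply: cvgD.
Qed.

(** By compactness of [0, 1] the image has a cluster point, and an ultrafilter converges to its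
    cluster points. *)
Lemma ultra_cvg_bounded (u : T -> R) : UltraFilter F ->
  (forall x, 0 <= u x <= 1)%R -> exists l : R, u @ F --> l.
Proof.
move=> UF u01; have PF := @ultra_proper _ _ UF.
have [|l [_ cl]] := @segment_compact R 0%R 1%R (u @ F) _.
  by apply: (@filterE _ F) => x; rewrite /= in_itv /=; exact: u01.
exists l => V lV; have [//|nV] := in_ultra_setVsetC (u @^-1` V) UF.
by have [y []] := cl _ _ (nV : (u @ F) (~` V)) lV.
Qed.

(** If convergence fails for some e, then [F] stays proper when restricted to the points where [u]
    is e-far from [l]; an ultrafilter refining this restriction contradicts the hypothesis. *)
Lemma cvg_of_ultra {FF : ProperFilter F} (u : T -> R) (l : R) :
  (forall G : set_system T, UltraFilter G -> F `<=` G -> u @ G --> l) ->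
  u @ F --> l.
Proof.
move=> H; apply/cvgrPdist_lt => e e0; apply: contrapT => nF.
pose E := [set x | ~ (`|l - u x| < e)%R].
have PE : ProperFilter (within E F).
  apply: Build_ProperFilter_ex => B FB; apply: contrapT => nB; apply: nF.
  apply: (@filterS _ F _ [set x | E x -> B x]) FB => x ExB; apply: contrapT => Ex.
  by apply: nB; exists x; exact: ExB.
have [G [UG EG]] := @ultraFilterLemma _ _ PE.
have FG : F `<=` G by move=> B FB; apply: EG; apply: filterS FB => x Bx _.
have PG := @ultra_proper _ _ UG.
have /cvgrPdist_lt/(_ _ e0) Gl := H G UG FG.
have GE : G E by apply: EG; apply: (@filterE _ F) => x.
have [x [ul nE]] := filter_ex (filterI Gl GE); exact: (nE ul).
Qed.

End UltrafilterLimits.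

Section Frequencies.
Variables (R : realType) (A : finType) (a0 : A) (L : seq A -> Prop).
Hypothesis HL : extendable_language L.
Local Notation p := (complexity L).

(** Counting suffixes makes consistency under left extension exact once n exceeds the length of [w];
    under right extension it holds in the limit. *)
Definition word_freq (w : seq A) (n : nat) : R :=
  (#|[set u in Ln L n | suffix w u]%SET|%:R / (p n)%:R)%R.

Lemma complexity_neq0 n : ((p n)%:R != 0 :> R)%R.
Proof. by rewrite pnatr_eq0 -lt0n; exact: complexity_gt0 HL _. Qed.

Lemma complexity_pos n : (0 < (p n)%:R :> R)%R.
Proof. by rewrite ltr0n; exact: complexity_gt0 HL _. Qed.

Lemma word_freq_nil n : word_freq [::] n = 1%R.
Proof.
rewrite /word_freq (_ : [set _ in _ | _]%SET = Ln L n) ?divff ?complexity_neq0 //.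
by apply/finset.setP => u; rewrite inE suffix0s andbT.
Qed.

Lemma word_freq_itv w n : (0 <= word_freq w n <= 1)%R.
Proof.
rewrite /word_freq divr_ge0 ?ler0n //= ler_pdivrMr ?complexity_pos // mul1r ler_nat.
by apply: subset_leq_card; apply/fintype.subsetP => u; rewrite inE => /andP[].
Qed.

Lemma suffix_cons_exists n (w : seq A) (u : n.-tuple A) : (size w < n)%N ->
  #|[pred a | suffix (a :: w) u]| = suffix w u.
Proof.
move=> wn; rewrite suffixE size_tuple.
rewrite (eq_card (B := [pred a | (a == nth a0 u (n - (size w).+1)) &&
  (drop (n - size w) u == w)])) => [|a]; last first.
  rewrite !inE suffixE /= size_tuple (drop_nth a0); last by rewrite size_tuple; lia.
  rewrite eqseq_cons eq_sym; congr (_ && (drop _ _ == _)); lia.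
case: eqP => _; last by rewrite eq_card0 // => a; rewrite !inE andbF.
by rewrite -[RHS](card1 (nth a0 u (n - (size w).+1))); apply: eq_card => a; rewrite !inE ?andbT.
Qed.

(** Double counting: each [u] is counted once for every admissible [i] with suffix [W i], that is 1
    or 0 times according to [P u]. *)
Lemma card_sum_suffix n (D : {set n.-tuple A}) (I : finType) (C : pred I)
    (W : I -> seq A) (P : pred (n.-tuple A)) :
  (forall u : n.-tuple A, #|[pred i | C i && suffix (W i) u]| = P u) ->
  (\sum_(i | C i) #|[set u in D | suffix (W i) u]%SET| = #|[set u in D | P u]%SET|)%N.
Proof.
move=> hW.
transitivity (\sum_(u in D) P u)%N.
  under eq_bigr do rewrite -sum1_card big_mkcond /=.
  rewrite exchange_big /= [RHS]big_mkcond; apply: eq_bigr => u _.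
  rewrite -hW -sum1_card [X in if _ then X else _]big_mkcondr /=.
  by case: ifP => uD; [apply: eq_bigr|rewrite big1] => // i _; rewrite !inE uD.
by rewrite -sum1_card [RHS]big_mkcond [LHS]big_mkcond /=; apply: eq_bigr => u _;
  rewrite inE; case: (u \in D) => //; case: (P u).
Qed.

Lemma word_freq_cons w n : (size w < n)%N ->
  word_freq w n = (\sum_a word_freq (a :: w) n)%R.
Proof.
move=> wn; rewrite /word_freq -mulr_suml -natr_sum.
rewrite (@card_sum_suffix n _ _ predT _ (fun u => suffix w u)) // => u.
exact: suffix_cons_exists.
Qed.

(** The sum counts the words of length n + 1 whose first n letters end in [w], and the other term
    those whose last n letters do. Both window counts are close to the same count over words of
    length n. *)
Lemma word_freq_rcons_error w n : (size w <= n)%N ->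
  (`|\sum_a word_freq (rcons w a) (n + 1) - word_freq w (n + 1)|
   <= 2 * (p (n + 1) - p n + 1)%:R / (p n)%:R)%R.
Proof.
have belast_last (s : seq A) : size s = n.+1 -> s = rcons (take n s) (last a0 s).
  case/lastP: s => // s b; rewrite size_rcons last_rcons => -[<-].
  by rewrite -cats1 take_size_cat ?cats1.
move=> wn; rewrite /word_freq -mulr_suml -natr_sum.
rewrite (@card_sum_suffix (n + 1) _ _ predT _ (fun u => suffix w (window a0 n 0 u))); last first.
  move=> u; have uE : val u = rcons (val (window a0 n 0 u)) (last a0 (val u)).
    rewrite val_window ?addn1 // drop0.
    by apply: belast_last; rewrite size_tuple addn1.
  rewrite (eq_card (B := [pred a | (a == last a0 (val u)) &&
      suffix w (window a0 n 0 u)])) => [|a]; last first.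
    by rewrite !inE -[tval u]/(val u) uE suffix_rcons last_rcons.
  case: (suffix w _); last by rewrite eq_card0 // => a; rewrite !inE andbF.
  by rewrite -[RHS](card1 (last a0 u)); apply: eq_card => a; rewrite !inE ?andbT.
rewrite [in X in (_ - X)%R](_ : [set _ in _ | _]%SET =
  [set u in Ln L (n + 1) | suffix w (window a0 n 1 u)]%SET); last first.
  apply/finset.setP => u; rewrite !inE; congr (_ && _).
  rewrite !suffixE !size_tuple val_window ?addn1 //.
  rewrite take_oversize ?size_drop ?size_tuple ?addn1 ?subn1 //.
  by rewrite drop_drop addnBAC.
set N0 := #|_|; set N1 := #|_|.
have l0 := @window_count_le _ a0 _ HL n 1 0 (fun v => suffix w v) (leq0n _).
have l1 := @window_count_le _ a0 _ HL n 1 1 (fun v => suffix w v) (leqnn _).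
have g0 := @window_count_ge _ a0 _ HL n 1 0 (fun v => suffix w v) (leq0n _).
have g1 := @window_count_ge _ a0 _ HL n 1 1 (fun v => suffix w v) (leqnn _).
have c01 : (N0 <= N1 + 2 * (p (n + 1) - p n + 1))%N.
  by apply: leq_trans g0 _; move: l1; rewrite -/N1; lia.
have c10 : (N1 <= N0 + 2 * (p (n + 1) - p n + 1))%N.
  by apply: leq_trans g1 _; move: l0; rewrite -/N0; lia.
rewrite -mulrBl normrM (ger0_norm (_ : 0 <= (p (n + 1))%:R^-1)%R) ?invr_ge0 ?ler0n //.
apply: ler_pM => //.
  move: c01 c10; rewrite -(ler_nat R) -[(N1 <= _)%N](ler_nat R) !natrD.
  by move=> c01 c10; rewrite ler_norml; apply/andP; split; lra.
rewrite lef_pV2 ?posrE ?complexity_pos // ler_nat.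
exact: complexity_mono HL _ _.
Qed.

Hypothesis Hp : complexity_hyp R L.

Lemma complexity_ratio m : (fun n => (p (n + m))%:R / (p n)%:R : R)%R @ \oo --> (1%R : R).
Proof.
elim: m => [|m IH].
  under eq_fun do rewrite addn0 divff ?complexity_neq0 //; exact: cvg_cst.
have -> : (fun n => (p (n + m.+1))%:R / (p n)%:R : R)%R =
    (fun n => ((p (n + m).+1)%:R / (p (n + m))%:R) * ((p (n + m))%:R / (p n)%:R))%R.
  by apply/funext => n; rewrite addnS mulrA divfK ?complexity_neq0.
rewrite -[X in _ --> X](mulr1 1%R); apply: cvgM => //.
by have := Hp.2; rewrite -(cvg_shiftn m).
Qed.

(** The complexity is monotone, so being unbounded it tends to infinity. *)
Lemma complexity_inv : (fun n => (p n)%:R^-1 : R)%R @ \oo --> (0%R : R).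
Proof.
apply/cvgrPdist_lt => e e0.
have [n0 n0M] := Hp.1 (Num.truncn (e^-1))%R.
exists n0 => // n /= n0n; rewrite sub0r normrN ger0_norm ?invr_ge0 //.
rewrite invf_plt ?posrE ?complexity_pos //.
have ie : (0 <= e^-1)%R by rewrite invr_ge0 ltW.
apply: (lt_le_trans (truncnS_gt (e^-1)%R)); rewrite ler_nat.
apply: leq_trans n0M _; rewrite -(subnKC n0n); exact: complexity_mono HL _ _.
Qed.

Lemma complexity_error m (c : R) :
  (fun n => c * (p (n + m) - p n + 1)%:R / (p n)%:R)%R @ \oo --> (0%R : R).
Proof.
have -> : (fun n => c * (p (n + m) - p n + 1)%:R / (p n)%:R : R)%R =
   (fun n => c * ((p (n + m))%:R / (p n)%:R - 1 + (p n)%:R^-1))%R.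
  apply/funext => n; rewrite natrD natrB; last exact: complexity_mono HL _ _.
  by field; exact: complexity_neq0.
rewrite -[X in _ --> X](mulr0 c) -[X in (c * X)%R](addr0 0%R) -[X in (X + 0)%R](subrr 1%R).
apply: cvgM; first exact: cvg_cst.
apply: cvgD; last exact: complexity_inv.
by apply: cvgB; [exact: complexity_ratio|exact: cvg_cst].
Qed.

Lemma cvg_word_freq_rcons w :
  (fun n => \sum_a word_freq (rcons w a) n - word_freq w n)%R @ \oo --> (0%R : R).
Proof.
rewrite -(cvg_shiftn 1); apply/cvgrPdist_lt => e e0.
have /cvgrPdist_lt/(_ _ e0) [n0 _ n0e] := complexity_error 1 2%R.
exists (n0 + size w)%N => // n /= n0n.
have nn0 : (n0 <= n)%N by apply: leq_trans n0n; exact: leq_addr.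
have nw : (size w <= n)%N by apply: leq_trans n0n; exact: leq_addl.
have := n0e n nn0; rewrite /= !sub0r !normrN; apply: le_lt_trans.
exact: le_trans (word_freq_rcons_error nw) (ler_norm _).
Qed.

End Frequencies.

Section NaturalExtension.
Variables (R : realType) (A : finType) (a0 : A) (L : seq A -> Prop).

Lemma measurable_natext : measurable (@natext A a0 L).
Proof.
have -> : @natext A a0 L = \bigcap_(n : nat) \bigcap_(k : nat)
   ([set x | L (block x (Posz k) n)] `&` [set x | L (block x (Negz k) n)]).
  apply/seteqP; split=> [x Lx n _ k _|x H [k|k] n]; first by split; exact: Lx.
    by have [] := H n Logic.I k Logic.I.
  by have [] := H n Logic.I k Logic.I.
apply: bigcapT_measurable => n; apply: bigcapT_measurable => k.
by apply: measurableI; exact: measurable_block.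
Qed.

(** The complement is a countable union of events that one given block lies outside [L], each
    covered by finitely many null cylinders. *)
Lemma natext_full (mu : probability (SpZ a0) R) :
  (forall i w, ~ L w -> mu (cylinder i w) = 0%E) -> mu (@natext A a0 L) = 1%E.
Proof.
move=> mu0.
have N i n : mu.-negligible [set x : SpZ a0 | ~ L (block x i n)].
  have mB := @measurable_block A a0 i n (fun w => ~ L w).
  have sz (x : SpZ a0) : size (block x i n) == n by rewrite size_block.
  have mw (w : n.-tuple A) : [set x | Tuple (sz x) = w] = cylinder i w.
    apply/seteqP; split=> x; rewrite /cylinder /= size_tuple; first by move=> <-.
    by move=> xw; apply: val_inj.
  suff m0 : mu [set x : SpZ a0 | ~ L (block x i n)] = 0%E by apply/negligibleP.
  rewrite (measure_partition mu (f := fun x : SpZ a0 => Tuple (sz x))) //; last first.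
    by move=> w; rewrite mw; exact: measurable_cylinder.
  apply: big1 => w _; rewrite mw.
  have [Lw|nLw] := pselect (L w).
    rewrite (_ : _ `&` _ = set0) ?measure0 //; apply/seteqP; split=> // x [/= nL].
    by rewrite /cylinder /= size_tuple => xw; apply: nL; rewrite xw.
  apply: (@subset_measure0 _ _ _ mu _ (cylinder i w)).
  - by apply: measurableI => //; exact: measurable_cylinder.
  - exact: measurable_cylinder.
  - by move=> x [].
  - exact: mu0.
have mE := measurable_natext.
suff : mu (~` @natext A a0 L) = 0%E.
  move=> E0; rewrite -[X in mu X]setCK probability_setC; last exact: measurableC.
  by rewrite E0 sube0.
apply: measure_negligible; first exact: measurableC.
have -> : ~` @natext A a0 L = \bigcup_(n : nat) \bigcup_(k : nat)
   ([set x | ~ L (block x (Posz k) n)] `|` [set x | ~ L (block x (Negz k) n)]).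
  apply/seteqP; split=> [x nx|x [n _ [k _ [nL|nL]]] Lx]; last 2 first.
  - by apply: nL; exact: Lx.
  - by apply: nL; exact: Lx.
  apply: contrapT => H; apply: nx => -[k|k] n; apply: contrapT => nL; apply: H;
    exists n => //; exists k => //; by [left|right].
apply: negligible_bigcup => n; apply: negligible_bigcup => k.
by apply: negligibleU; exact: N.
Qed.

End NaturalExtension.

(** The difference splits into (b - d) / u and d / u - d / v, and the latter lies between 0 and (v -
    u) / u because d <= v. In the application u and v are p(n) and p(n + m). *)
Lemma ratio_error (R : realType) (b c d u v : R) :
  (0 < u -> u <= v -> 0 <= d <= v ->
   b <= d + c * (v - u + 1) -> d <= b + c * (v - u + 1) ->
   - ((c + 1) * (v - u + 1) / u) <= b / u - d / v <= (c + 1) * (v - u + 1) / u)%R.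
Proof.
move=> u0 uv /andP[d0 dv] c1 c2; have v0 := lt_le_trans u0 uv.
have dE : (0 <= d / u - d / v <= (v - u) / u)%R.
  have -> : (d / u - d / v = (d / v) * ((v - u) / u))%R by field; lra.
  have vu : (0 <= (v - u) / u)%R by rewrite divr_ge0 ?subr_ge0 // ltW.
  apply/andP; split; first by apply: mulr_ge0 => //; exact: divr_ge0 d0 (ltW v0).
  by apply: ler_piMl => //; rewrite ler_pdivrMr // mul1r.
have b1 : (b / u <= d / u + c * (v - u + 1) / u)%R.
  by rewrite -mulrDl ler_pM2r ?invr_gt0.
have b2 : (d / u <= b / u + c * (v - u + 1) / u)%R.
  by rewrite -mulrDl ler_pM2r ?invr_gt0.
have u1 : (0 < 1 / u)%R by rewrite divr_gt0.
move: dE => /andP[dE1 dE2].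
have -> : ((c + 1) * (v - u + 1) / u = c * (v - u + 1) / u + (v - u) / u + 1 / u)%R.
  by field; lra.
by apply/andP; split; lra.
Qed.

(** * Convergence of word and ball frequencies *)

Section WordFrequencyLimit.
Variables (R : realType) (A : finType) (a0 : A) (L : seq A -> Prop).
Hypothesis HL : extendable_language L.
Hypothesis Hp : complexity_hyp R L.

Lemma ultralimit_law (F : set_system nat) : UltraFilter F -> \oo `<=` F ->
  exists mu : probability (SpZ a0) R,
  [/\ shift_invariant (@shiftZ A a0) mu, mu (@natext A a0 L) = 1%E &
      forall i w, word_freq R L w @ F --> fine (mu (cylinder i w))].
Proof.
move=> UF ooF; have PF := @ultra_proper _ _ UF.
have [q qP] : exists q : seq A -> R, forall w, word_freq R L w @ F --> q w.
  have h w : exists l : R, word_freq R L w @ F --> l.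
    exact: ultra_cvg_bounded UF (word_freq_itv R HL w).
  by have [q qP] := choice h; exists q.
(* Identities valid up to o(1) at infinity become equalities of limits along [F], as [F] refines the
   Frechet filter. *)
have lim_eq (u v : nat -> R) (l l' : R) : u @ F --> l -> v @ F --> l' ->
    (u \- v)%R @ \oo --> (0%R : R) -> l = l'.
  move=> ul vl' uv0; apply/eqP; rewrite -subr_eq0; apply/eqP.
  apply: (@cvg_unique R (@norm_hausdorff _ R) ((u \- v)%R @ F)).
    exact: cvgB.
  by apply: cvg_trans uv0; move=> B; exact: ooF.
have q1 : q [::] = 1%R.
  apply: (lim_eq _ (fun=> 1%R) _ _ (qP [::]) (@cvg_cst _ _ _ _ _)).
  rewrite (_ : (_ \- _)%R = fun=> 0%R); first exact: cvg_cst.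
  by apply/funext => n /=; rewrite (word_freq_nil R HL) subrr.
have q0 w : (0 <= q w)%R.
  apply: (@closed_cvg _ _ F _ (word_freq R L w) (fun x => 0 <= x)%R _ _ _ (qP w)).
    exact: closed_ge.
  by apply: filterE => n; have /andP[] := word_freq_itv R HL w n.
have qc w : q w = (\sum_a q (a :: w))%R.
  apply: (lim_eq (word_freq R L w) (fun n => \sum_a word_freq R L (a :: w) n)%R) => //.
    by apply: cvg_bigsum => a; exact: qP.
  apply: cvg_trans (@cvg_cst R 0%R _ \oo _); apply: near_eq_cvg.
  exists (size w).+1 => // n /= wn.
  by rewrite -(word_freq_cons R a0 L) // subrr.
have qr w : q w = (\sum_a q (rcons w a))%R.
  apply/esym; apply: (lim_eq (fun n => \sum_a word_freq R L (rcons w a) n)%R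
    (word_freq R L w)) => //.
    by apply: cvg_bigsum => a; exact: qP.
  exact: (cvg_word_freq_rcons a0 HL Hp w).
have [mu [mui muq]] := exists_shift_invariant_law a0 q1 q0 qc qr.
exists mu; split => //; last by move=> i w; rewrite muq /=; exact: qP.
apply: natext_full => i w nLw; rewrite muq.
(* Suffixes of words of [L] belong to [L], so the frequency of [w] vanishes identically. *)
have -> // : q w = 0%R.
apply: (lim_eq _ (fun=> 0%R) _ _ (qP w) (@cvg_cst _ _ _ _ _)).
rewrite (_ : (_ \- _)%R = fun=> 0%R); first exact: cvg_cst.
apply/funext => n /=; rewrite subr0 /word_freq (_ : [set _ in _ | _]%SET = finset.set0).
  by rewrite cards0 mul0r.
apply/finset.setP => u; rewrite !inE; apply/negP => /andP[Lu /suffixP[s us]].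
apply: nLw; case: HL => _ fac _ _; apply: (fac s w [::]).
by rewrite cats0 -us; apply/asboolP; rewrite Lu.
Qed.

Hypothesis Hunique : forall mu nu : probability (SpZ a0) R,
  shift_invariant (@shiftZ A a0) mu -> mu (@natext A a0 L) = 1%E ->
  shift_invariant (@shiftZ A a0) nu -> nu (@natext A a0 L) = 1%E ->
  forall B, measurable B -> mu B = nu B.

(** One ultrafilter supplies the measure; by uniqueness the limits along every other one agree with
    it, and [cvg_of_ultra] concludes. *)
Lemma word_freq_law : exists mu : probability (SpZ a0) R,
  [/\ shift_invariant (@shiftZ A a0) mu, mu (@natext A a0 L) = 1%E &
      forall i w, word_freq R L w @ \oo --> fine (mu (cylinder i w))].
Proof.
have [F [UF ooF]] := @ultraFilterLemma _ \oo _.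
have [mu [mui mun mul]] := ultralimit_law UF ooF.
exists mu; split => // i w; apply: cvg_of_ultra => G UG ooG.
have [nu [nui nun nul]] := ultralimit_law UG ooG.
rewrite (Hunique mui mun nui nun) //; exact: measurable_cylinder.
Qed.

Lemma path_ball_eq r (w w' : nat -> A) (V : Type) arc (v : V) g :
  (forall i, (i < 2 * r)%N -> w i = w' i) ->
  path_ball r w arc v g -> path_ball r w' arc v g.
Proof.
move=> ww [gr ginj gW garc]; split => // i a j ir jr; rewrite garc //.
by split=> -[ji ->]; split => //; rewrite ww // -ji.
Qed.

(** Only the labels at -r, ..., r - 1 enter the ball; this turns the ball event into a finite union
    of cylinders. *)
Lemma line_ball_block r k (H : 'I_k -> A -> 'I_k -> bool) o (x : int -> A) :
  ball_iso (line_arc x) 0%R r H o <->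
  ball_iso (line_arc (word_to_line a0 r (block x (- r%:Z)%R (2 * r).+1))) 0%R r H o.
Proof.
have pw : path_ball r (fun i => x (i%:Z - r%:Z)%R)
    (line_arc (word_to_line a0 r (block x (- r%:Z)%R (2 * r).+1))) 0%R
    (fun i => (i%:Z - r%:Z)%R).
  apply: path_ball_eq (line_path_ball r _) => i ir.
  by rewrite /word_to_line subrK absz_nat nth_block 1?addrC //; lia.
have pl := line_path_ball r x.
by split; [exact: ball_iso_path_transfer pl pw|exact: ball_iso_path_transfer pw pl].
Qed.

Section BallLaw.
Variables (r k : nat) (H : 'I_k -> A -> 'I_k -> bool) (o : 'I_k).
Local Notation m := (2 * r).+1.
Let Q (w : seq A) := `[< ball_iso (line_arc (word_to_line a0 r w)) 0%R r H o >].

Lemma line_ball_law (mu : probability (SpZ a0) R) :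
  (mu [set x : SpZ a0 | ball_iso (line_arc x) 0%R r H o] =
   (\sum_(w : m.-tuple A | Q w) fine (mu (cylinder (- r%:Z)%R w)))%:E)%E.
Proof.
have mc w : measurable (cylinder (- r%:Z)%R w : set (SpZ a0)).
  exact: measurable_cylinder.
have sz (x : SpZ a0) : size (block x (- r%:Z)%R m) == m by rewrite size_block.
have fw (w : m.-tuple A) : [set x | Tuple (sz x) = w] = cylinder (- r%:Z)%R w.
  apply/seteqP; split=> x; rewrite /cylinder /= size_tuple; first by move=> <-.
  by move=> xw; apply: val_inj.
have -> : [set x : SpZ a0 | ball_iso (line_arc x) 0%R r H o] =
    [set x : SpZ a0 | Q (block x (- r%:Z)%R m)].
  by apply/seteqP; split=> x /= => [bx|/asboolP bx];
    [apply/asboolP; exact: (@line_ball_block r k H o x).1|exact: (@line_ball_block r k H o x).2].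
rewrite (measure_partition mu (f := fun x : SpZ a0 => Tuple (sz x))).
- rewrite -sumEFin [RHS]big_mkcond; apply: eq_bigr => w _; rewrite fw.
  case: ifP => Qw.
    rewrite fineK ?fin_num_measure //; congr (mu _); apply/seteqP; split=> [x []//|x xw].
    split => //=; move: xw; rewrite /cylinder /= size_tuple => ->; exact: Qw.
  rewrite (_ : _ `&` _ = set0) ?measure0 //; apply/seteqP; split=> // x [/= Qx].
  by rewrite /cylinder /= size_tuple => xw; move: Qx; rewrite xw Qw.
- exact: (measurable_block _ _ Q).
- by move=> w; rewrite fw.
Qed.

(** Among the words of length [m], exactly one is a suffix of [U], namely [drop n U]. *)
Lemma suffix_ball_freq n :
  (#|[set U in Ln L (n + m) | Q (drop n U)]%SET|%:R / (complexity L (n + m))%:R =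
   \sum_(w : m.-tuple A | Q w) word_freq R L w (n + m))%R.
Proof.
rewrite /word_freq -mulr_suml -natr_sum.
rewrite (@card_sum_suffix _ (n + m) _ _ _ _ (fun U => Q (drop n U))) // => U.
have sU : size (drop n U) == m by rewrite size_drop size_tuple addKn.
have E (w : m.-tuple A) : suffix w U = (w == Tuple sU).
  by rewrite suffixE !size_tuple addnK eq_sym.
rewrite (eq_card (B := [pred w | (w == Tuple sU) && Q (drop n U)])) => [|w]; last first.
  by rewrite !inE E andbC; case: eqP => // ->.
case: (Q _); last by rewrite eq_card0 // => w; rewrite !inE andbF.
by rewrite -[RHS](card1 (Tuple sU)); apply: eq_card => w; rewrite !inE ?andbT.
Qed.

Lemma cvg_rauzy_ball_freq (mu : probability (SpZ a0) R) :
  (forall i w, word_freq R L w @ \oo --> fine (mu (cylinder i w))) ->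
  (fun n => rauzy_ball_freq R L n r H o) @ \oo -->
    fine (mu [set x : SpZ a0 | ball_iso (line_arc x) 0%R r H o]).
Proof.
move=> muw; rewrite line_ball_law /=.
pose D n := #|[set U in Ln L (n + m) | Q (drop n U)]%SET|.
have Dl : (fun n => (D n)%:R / (complexity L (n + m))%:R)%R @ \oo -->
    (\sum_(w : m.-tuple A | Q w) fine (mu (cylinder (- r%:Z)%R w)))%R.
  under eq_fun do rewrite suffix_ball_freq.
  apply: cvg_bigsum => w.
  by have := muw (- r%:Z)%R w; rewrite -(cvg_shiftn m).
have [K hK] := @rauzy_ball_count A a0 L HL r k H o.
pose err n := ((K + 1)%:R * (complexity L (n + m) - complexity L n + 1)%:R /
  (complexity L n)%:R : R)%R.
have err0 : err @ \oo --> (0%R : R) by exact: (complexity_error a0 HL Hp m (K + 1)%:R%R).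
(* The suffix statistics give the limit, and their difference from the ball frequency is squeezed
   between [- err] and [err] by [ratio_error]. *)
rewrite -[X in _ --> X]addr0.
rewrite (_ : (fun n => rauzy_ball_freq R L n r H o) = (fun n =>
   (D n)%:R / (complexity L (n + m))%:R + (rauzy_ball_freq R L n r H o -
     (D n)%:R / (complexity L (n + m))%:R))%R); last first.
  by apply/funext => n; rewrite addrC subrK.
apply: cvgD => //; apply: (@squeeze_cvgr _ _ _ _ (fun n => - err n)%R err) => //; last first.
  by rewrite -oppr0; exact: cvgN.
apply: filterE => n; have [c1 c2] := hK n.
rewrite /rauzy_ball_freq; set B := #|_|%:R%R.
have {}c1 : (B <= (D n)%:R + K%:R * (complexity L (n + m) - complexity L n + 1)%:R :> R)%R.
  by rewrite -natrM -natrD ler_nat.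
have {}c2 : ((D n)%:R <= B + K%:R * (complexity L (n + m) - complexity L n + 1)%:R :> R)%R.
  by rewrite -natrM -natrD ler_nat.
have Dp : ((D n)%:R <= (complexity L (n + m))%:R :> R)%R.
  rewrite ler_nat; apply: subset_leq_card; apply/fintype.subsetP => U.
  by rewrite inE => /andP[].
have D0 : (0 <= (D n)%:R :> R)%R by [].
have pn := complexity_pos R HL n.
have pnm := complexity_mono a0 HL n m.
move: c1 c2; rewrite /err !natrD (natrB _ pnm) => c1 c2.
by apply: ratio_error => //; [rewrite ler_nat|rewrite D0].
Qed.

End BallLaw.

Lemma BS_of_unique : BS_conclusion R a0 L.
Proof.
have [mu [mui mun mul]] := word_freq_law; exists mu; split => //.
  by move=> nu nui nun; exact: Hunique nui nun mui mun.
by move=> r k H o; exact: cvg_rauzy_ball_freq mul.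
Qed.

End WordFrequencyLimit.

(** * Languages of orbits and the main theorem *)

Section OrbitLanguages.
Variable A : finType.

Lemma block_cat (x : int -> A) i m n :
  block x i (m + n) = block x i m ++ block x (i + m%:Z)%R n.
Proof.
elim: n => [|n IH]; first by rewrite addn0 cats0.
by rewrite addnS !blockS IH rcons_cat; congr (_ ++ rcons _ (x _)); lia.
Qed.

(* Words of a one-sided sequence are those starting at nonnegative positions
   of any two-sided continuation, so both languages have this form. *)
Lemma orbit_language_extendable (x : int -> A) (one_sided : bool) (L : seq A -> Prop) :
  (forall w, L w <-> exists k : int,
     (one_sided -> (0 <= k)%R) /\ w = block x k (size w)) ->
  extendable_language L.
Proof.
move=> LE; split.
- by apply/LE; exists 0%R.
- move=> s v t /LE[k [k0 svt]]; apply/LE; exists (k + (size s)%:Z)%R; split.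
    by move=> /k0; lia.
  move: svt; rewrite !size_cat !block_cat => /eqP.
  by rewrite eqseq_cat ?size_block // eqseq_cat ?size_block // => /and3P[_ /eqP].
- move=> v j /LE[k [k0 vE]]; exists (block x (k + (size v)%:Z)%R j).
    by rewrite size_block.
  by apply/LE; exists k; split => //; rewrite size_cat size_block block_cat -vE.
(* In a one-sided sequence only words starting at positions 0, ..., i - 1 can fail to extend by [i]
   letters to the left; [f] lists them. *)
- move=> n i; pose f (k : 'I_i) : n.-tuple A := [tuple x (k%:Z + j%:Z)%R | j < n].
  rewrite -[leqRHS]card_ord; apply: leq_trans (leq_imset_card f predT).
  apply: subset_leq_card; apply/fintype.subsetP => v; rewrite !inE.
  move=> [/LE[k [k0 vE]] nv].
  have vk (t : seq A) : size t = i -> t = block x (k - i%:Z)%R i ->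
      t ++ v = block x (k - i%:Z)%R (size (t ++ v)).
    by move=> ti tE; rewrite size_cat ti block_cat -tE subrK -vE.
  have : one_sided /\ (k < i%:Z)%R.
    apply: contrapT => H; apply: (nv (block x (k - i%:Z)%R i)); first by rewrite size_block.
    apply/LE; exists (k - i%:Z)%R; split; last by apply: vk; rewrite ?size_block.
    by move=> os; rewrite subr_ge0 leNgt; apply/negP => ki; apply: H.
  move=> [os ki]; have k00 := k0 os.
  have ki' : (`|k| < i)%N by lia.
  apply/imsetP; exists (Ordinal ki') => //; apply: val_inj; rewrite -[LHS]/(tval v) vE size_tuple.
  apply: (@eq_from_nth _ (x 0%R)) => [|j]; rewrite ?size_tuple ?size_block // => jn.
  rewrite nth_block // -[j]/(val (Ordinal jn)) -tnth_nth tnth_mktuple /=.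
  by congr x; lia.
Qed.

Lemma inL2_extendable (omega : int -> A) : extendable_language (inL2 omega).
Proof.
apply: (@orbit_language_extendable omega false) => w.
by split=> -[k]; [exists k|move=> [_ wE]; exists k].
Qed.

Lemma inL1_extendable (omega : nat -> A) : extendable_language (inL1 omega).
Proof.
apply: (@orbit_language_extendable (fun i => omega `|i|%N) true) => w.
split=> [[k wE]|[k [/(_ isT) k0 wE]]].
  by exists (k%:Z)%R; split=> //; rewrite {1}wE; apply: eq_mkseq => j; congr omega; lia.
exists `|k|%N; rewrite {1}wE; apply: eq_mkseq => j; congr omega; lia.
Qed.

(** Agreement with a shift of [omega] on [-n, n] is the occurrence in [omega] of a block of length
    2n + 1. In the two-sided case unique ergodicity is thus directly uniqueness on the natural
    extension. *)
Lemma Sigma2_natext (omega : int -> A) : @Sigma2 A omega = @natext A (omega 0%R) (inL2 omega).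
Proof.
apply/seteqP; split=> x xS.
  move=> i n; have [k kx] := xS (`|i| + n)%N; exists (i + k)%R.
  rewrite size_mkseq; apply: (@eq_from_nth _ (omega 0%R)) => [|j]; rewrite !size_mkseq // => jn.
  rewrite !nth_mkseq // kx; last by lia.
  by congr omega; lia.
move=> n; have [k kx] := xS (- n%:Z)%R (2 * n).+1; exists (k + n%:Z)%R => i ni.
have := congr1 (nth (omega 0%R) ^~ `|(i + n%:Z)%R|%N) kx.
rewrite size_mkseq !nth_mkseq; try lia.
rewrite (_ : - n%:Z + `|(i + n%:Z)%R|%N%:Z = i)%R; last by lia.
by move=> ->; congr omega; lia.
Qed.

Lemma measurable_prefix (a0 : A) n (P : seq A -> Prop) :
  measurable [set x : SpN a0 | P (mkseq x n)].
Proof.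
have mw w : measurable [set x : SpN a0 | mkseq x (size w) = w].
  elim/last_ind: w => [|w a IH].
    by rewrite (_ : [set _ | _] = setT) //; apply/seteqP; split.
  rewrite (_ : [set _ | _] = [set x : SpN a0 | mkseq x (size w) = w] `&`
      [set x : SpN a0 | x (size w) = a]).
    by apply: measurableI => //; apply: sub_sigma_algebra; exists (size w), a.
  apply/seteqP; split=> x /=; rewrite size_rcons mkseqS; first by move/rcons_inj => -[-> ->].
  by move=> [-> ->].
have -> : [set x : SpN a0 | P (mkseq x n)] = \bigcup_(w : seq A)
    (if `[< P w /\ size w = n >] then [set x : SpN a0 | mkseq x (size w) = w] else set0).
  apply/seteqP; split=> [x Px|x [w _]].
    exists (mkseq x n) => //; case: asboolP => [_|[]]; last by rewrite size_mkseq.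
    by rewrite /= size_mkseq.
  by case: asboolP => [[Pw <-]|] //= => ->.
apply: countable_bigcupT_measurable; first exact: countableP.
by move=> w; case: ifP.
Qed.

Lemma measurable_Sigma1 (omega : nat -> A) : measurable (@Sigma1 A omega).
Proof.
have -> : @Sigma1 A omega = \bigcap_(n : nat) [set x : SpN (omega 0%N) |
    exists k, mkseq x n = mkseq (fun i => omega (k + i)%N) n].
  apply/seteqP; split=> [x xS n _|x xS n].
    have [k kx] := xS n; exists k; apply: (@eq_from_nth _ (omega 0%N)) => [|j];
      by rewrite !size_mkseq // => jn; rewrite !nth_mkseq // kx.
  have [k kx] := xS n Logic.I; exists k => i ni.
  by have := congr1 (nth (omega 0%N) ^~ i) kx; rewrite !nth_mkseq.
apply: bigcapT_measurable => n.
exact: (@measurable_prefix _ n (fun w => exists k, w = mkseq (fun i => omega (k + i)%N) n)).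
Qed.

End OrbitLanguages.

(** * Uniqueness on the natural extension of a one-sided subshift *)

Section OneSidedUniqueness.
Variables (R : realType) (A : finType) (omega : nat -> A).
Local Notation a0 := (omega 0%N).

Definition half_line (x : SpZ a0) : SpN a0 := fun i => x (Posz i).

Lemma measurable_half_line : measurable_fun setT half_line.
Proof.
apply: (@measurability _ _ _ (SpN a0) setT _ (@cylN A a0)) => // _ [_ [i [a ->]] <-].
by rewrite setTI; exact: (measurable_letter (Posz i) a).
Qed.

(** An invariant measure on the natural extension projects to one on [Sigma1] and is recovered from
    it: by invariance only cylinders at position 0 matter, and these are events of the half line. *)
Lemma one_sided_unique :
  uniquely_ergodic R (@shiftN A a0) (@Sigma1 A omega) ->
  forall mu nu : probability (SpZ a0) R,
  shift_invariant (@shiftZ A a0) mu -> mu (@natext A (omega 0%N) (inL1 omega)) = 1%E ->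
  shift_invariant (@shiftZ A a0) nu -> nu (@natext A (omega 0%N) (inL1 omega)) = 1%E ->
  forall B, measurable B -> mu B = nu B.
Proof.
move=> [_ uniq] mu nu mui mun nui nun.
have proj (la : probability (SpZ a0) R) :
    shift_invariant (@shiftZ A a0) la -> la (@natext A (omega 0%N) (inL1 omega)) = 1%E ->
  exists la' : probability (SpN a0) R, [/\ shift_invariant (@shiftN A a0) la',
     la' (@Sigma1 A omega) = 1%E & forall B, la' B = la (half_line @^-1` B)].
  move=> lai lan; have [la' laE] := probability_pushforward la measurable_half_line.
  exists la'; split => //.
    move=> B mB; rewrite !laE -(lai (half_line @^-1` B)).
      congr (la _); have E x : shiftN (half_line x) = half_line (shiftZ x).
        by apply/funext => i; rewrite /half_line /shiftN /shiftZ; congr x; lia.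
      by apply/seteqP; split=> x /=; rewrite E.
    by rewrite -[X in measurable X]setTI; exact: measurable_half_line.
  have mS : measurable (half_line @^-1` @Sigma1 A omega).
    rewrite -[X in measurable X]setTI; apply: measurable_half_line => //.
    exact: measurable_Sigma1.
  apply/eqP; rewrite laE eq_le probability_le1 //= -lan le_measure ?inE //.
    exact: measurable_natext.
  move=> x xn n; have [k kE] := xn 0%R n; exists k => i ni.
  by have := congr1 (nth a0 ^~ i) kE; rewrite size_mkseq !nth_mkseq //.
have [mu' [mui' mun' muE]] := proj mu mui mun.
have [nu' [nui' nun' nuE]] := proj nu nui nun.
apply: cylinder_measure_unique => i w.
rewrite (shift_invariant_cylinder _ _ mui) (shift_invariant_cylinder _ _ nui).
pose C : set (SpN a0) := [set x | mkseq x (size w) = w].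
have CE : cylinder 0%R w = half_line @^-1` C.
  by apply/seteqP; split.
rewrite CE -muE -nuE; apply: (uniq mu' nu') => //.
exact: (@measurable_prefix _ _ (size w) (fun v => v = w)).
Qed.

End OneSidedUniqueness.

Theorem theorem1p3 (R : realType) (A : finType) :
  (forall omega : nat -> A,
     uniquely_ergodic R (@shiftN A (omega 0%N)) (@Sigma1 A omega) ->
     complexity_hyp R (inL1 omega) ->
     BS_conclusion R (omega 0%N) (inL1 omega)) /\
  (forall omega : int -> A,
     uniquely_ergodic R (@shiftZ A (omega 0%R)) (@Sigma2 A omega) ->
     complexity_hyp R (inL2 omega) ->
     BS_conclusion R (omega 0%R) (inL2 omega)).
Proof.
split=> omega ue cplx.
  apply: BS_of_unique => //; first exact: inL1_extendable.
  exact: one_sided_unique ue.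
apply: BS_of_unique => //; first exact: inL2_extendable.
by rewrite -Sigma2_natext; case: ue.
Qed.
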